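(* Let $\xi_1,\dots,\xi_n$ be i.i.d. real random variables with characteristic function $\varphi$ satisfying $\inf_{u\in\mathbb{R}}|\varphi(u)|>0$, let $\varphi_n(u)=n^{-1}\sum_{k=1}^ne^{iu\xi_k}$, and let $h_n\to0$ with $\log(h_n^{-1})/n^{1/(1+2\delta)}\to0$ for some $\delta>0$. If $\mathbb{E}[\log^\beta(\max\{|\xi_1|,e\})]<\infty$ for some $\beta>1$, then $\mathrm{Log}(\varphi_n(u)/\varphi(u))\mathbf{1}_{\{|u|\le h_n^{-1}\}}$ is well defined and finite on events whose probability tends to one as $n\to\infty$, and on these events $$\mathrm{Log}\frac{\varphi_n(u)}{\varphi(u)}=(\varphi_n(u)-\varphi(u))\varphi^{-1}(u)+R_n(u),\qquad u\in[-h_n^{-1},h_n^{-1}],$$ where $R_n(u):=R(\varphi_n(u)/\varphi(u))$ with $R(z)=\int_1^z\frac{s-z}{s^2}ds$ (integral along the segment from $1$ to $z$), and $\sup_{|u|\le h_n^{-1}}|R_n(u)|=O_{\mathbb P}\big(n^{-1}(\log h_n^{-1})^{1+2\bar\delta}\big)$ for any $\bar\delta\in(0,\delta]$.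
   Context: $\varphi^{-1}=1/\varphi$. For a continuous nonvanishing function $\psi$ on an interval containing $0$ with $\psi(0)=1$, $\mathrm{Log}\,\psi$ denotes its distinguished logarithm: the unique continuous function with $\mathrm{Log}\,\psi(0)=0$ and $e^{\mathrm{Log}\,\psi}=\psi$. $O_{\mathbb P}(r_n)$: bounded in probability after division by $r_n$. *)

(* Defs.v *)
From HB Require Import structures.
From mathcomp Require Import all_boot all_order all_algebra.
From mathcomp Require Import all_classical all_reals all_analysis.
From mathcomp Require Import complex.

Set Implicit Arguments.
Unset Strict Implicit.
Unset Printing Implicit Defensive.

Import Order.TTheory GRing.Theory Num.Theory.
Import numFieldNormedType.Exports.

Local Open Scope classical_set_scope.
Local Open Scope ring_scope.

Section defs.
Context (R : realType).

Definition cexp (z : R[i]) : R[i] :=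
  Complex (expR (complex.Re z) * cos (complex.Im z)) (expR (complex.Re z) * sin (complex.Im z)).

Definition eix (x : R) : R[i] := Complex (cos x) (sin x).

(* R(z) = \int_1^z (s - z)/s^2 ds along the segment [1, z], parametrized by
   s(t) = 1 + t (z - 1), t in [0,1], ds = (z - 1) dt; the complex integral is
   the integral of the real part plus i times the integral of the imaginary part. *)
Definition Rrem_integrand (z : R[i]) (t : R) : R[i] :=
  let s := 1 + (t%:C)%C * (z - 1) in (s - z) / (s ^+ 2) * (z - 1).

Definition Rrem (z : R[i]) : R[i] :=
  Complex (\int[lebesgue_measure]_(t in `[0, 1]) complex.Re (Rrem_integrand z t))
          (\int[lebesgue_measure]_(t in `[0, 1]) complex.Im (Rrem_integrand z t)).

(* distinguished logarithm of psi on [-a, a]: L continuous on [-a,a]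
   (continuity of a C-valued map = continuity of its real and imaginary parts),
   L 0 = 0 and exp (L u) = psi u on [-a, a]. *)
Definition is_dlog (psi : R -> R[i]) (a : R) (L : R -> R[i]) : Prop :=
  {within `[- a, a], continuous (fun u => complex.Re (L u))} /\
  {within `[- a, a], continuous (fun u => complex.Im (L u))} /\
  L 0 = 0 /\
  (forall u, `|u| <= a -> cexp (L u) = psi u).

Context {d : measure_display} {T : measurableType d} (P : probability T R).

Definition charfun (X : T -> R) (u : R) : R[i] :=
  Complex (fine ('E_P[fun w => cos (u * X w)])%E) (fine ('E_P[fun w => sin (u * X w)])%E).

Definition emp_charfun (xi : nat -> T -> R) (n : nat) (u : R) (w : T) : R[i] :=
  ((n%:R^-1)%:C)%C * \sum_(k < n) eix (u * xi k w).

Definition iid (xi : nat -> T -> R) : Prop :=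
  (forall k, measurable_fun setT (xi k)) /\
  (forall k (B : set R), measurable B -> P (xi k @^-1` B) = P (xi 0%N @^-1` B)) /\
  (forall (n : nat) (B : nat -> set R), (forall i, measurable (B i)) ->
     P (\bigcap_(i in `I_n) (xi i @^-1` B i)) = (\prod_(i < n) P (xi i @^-1` B i))%E).

End defs.

(* Main.v *)
(* Put L = log (1/h) and D f = n^-1 sum_k f (xi_k) - E f (xi_0). The heart of the
   matter is sup_{|u| <= e^L} |phi_n - phi| = O_P (sqrt (L / n)). Split the line
   into the shells e^(l_(j-1)) < |x| <= e^(l_j) with l_j = L 2^j. On the j-th
   shell the functions x |-> e^(iux) have frequency at most e^(l_j), so e^(O(l_j))
   grid points in u together with Taylor expansion at these points reduce the
   supremum to finitely many D f with |f| <= 1, each controlled by Bernstein's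
   inequality. The log-moment bounds the variance on the shell by O(2^(-j beta)),
   so the shell contributes sqrt (2^(j (1 - beta)) L / n) + l_j / n, which is
   summable over the shells with l_j up to order sqrt n; beyond them the tail
   probability is itself O(n^(-1/2)).
   Once |phi_n / phi - 1| <= 1/2, the distinguished logarithm is the principal
   one, and log z = (z - 1) + R z because log s + z / s is a primitive of
   (s - z) / s^2; moreover |R z| <= 8 |z - 1|^2. *)
Require Import Defs.
From HB Require Import structures.
From mathcomp Require Import all_boot all_order all_algebra.
From mathcomp Require Import all_classical all_reals all_analysis.
From mathcomp Require Import measurable_realfun complex ring lra.

Set Implicit Arguments.
Unset Strict Implicit.
Unset Printing Implicit Defensive.

Import Order.TTheory GRing.Theory Num.Theory.
Import numFieldNormedType.Exports.

Local Open Scope classical_set_scope.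
Local Open Scope ring_scope.

(** * Bounded random variables and products of i.i.d. factors *)

(** Truncating at [e^L] can leave a tail probability, of order [L^(-beta)], above the target
    [sqrt (L / n)]; truncating at once at [e^(sqrt n)] makes the grid cost [sqrt n] in the exponent
    with no small variance to offset it. Shells pair each cost with its own variance: from one shell
    to the next the cost [l_j] doubles while the variance bound is multiplied by [2^(-beta)], and
    the product shrinks geometrically because [beta > 1]. Taylor polynomials replace a Lipschitz
    estimate because [L] may grow more slowly than [log n]: a Lipschitz error of order [n^(-1/2)]
    requires a mesh depending on [n], whose union bound costs an additional [log n]. Here the mesh
    depends only on the shell, the accuracy comes from the degree [K], and the degree is free since
    the coefficients decay like [2^(-m)]. The confidence parameter [b] stays free: a fixed [b] gives
    the rate in probability, and [b] tending to infinity gives events of probability tending to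
    one. *)

Section BoundedExpectation.
Context {R : realType} {d : measure_display} {T : measurableType d} (P : probability T R).

(** This class is closed under sums and products and consists of integrable functions, so it
    discharges the side conditions of every linearity step below. *)
Definition bounded_rv (f : T -> R) : Prop :=
  measurable_fun setT f /\ exists C, forall x, `|f x| <= C.

Lemma bounded_rv_integrable f : bounded_rv f -> P.-integrable setT (EFin \o f).
Proof.
move=> [mf [C fC]]; apply: measurable_bounded_integrable => //.
  by rewrite [X in (X < _)%E](@probability_setT _ _ _ P) ltry.
exists C; split; first by rewrite num_real.
by move=> M CM x _; apply: le_trans (fC x) (ltW CM).
Qed.

Lemma bounded_rv_cst r : bounded_rv (fun=> r).
Proof. by split; [exact: measurable_cst | exists `|r|]. Qed.

Lemma bounded_rvD f g : bounded_rv f -> bounded_rv g ->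
  bounded_rv (fun x => f x + g x).
Proof.
move=> [mf [C fC]] [mg [D gD]]; split; first exact: measurable_realfun.measurable_funD.
by exists (C + D) => x; rewrite (le_trans (ler_normD _ _))// lerD.
Qed.

Lemma bounded_rvM f g : bounded_rv f -> bounded_rv g ->
  bounded_rv (fun x => f x * g x).
Proof.
move=> [mf [C fC]] [mg [D gD]]; split; first exact: measurable_realfun.measurable_funM.
by exists (C * D) => x; rewrite normrM ler_pM.
Qed.

Lemma bounded_rvZ r f : bounded_rv f -> bounded_rv (fun x => r * f x).
Proof. by move=> bf; apply: bounded_rvM => //; exact: bounded_rv_cst. Qed.

Lemma bounded_rvB f g : bounded_rv f -> bounded_rv g ->
  bounded_rv (fun x => f x - g x).
Proof.
move=> bf bg; rewrite [X in bounded_rv X](_ : _ = fun x => f x + -1 * g x).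
  by apply: bounded_rvD => //; exact: bounded_rvZ.
by apply/funext => x; rewrite mulN1r.
Qed.

Lemma bounded_rv_indic (A : set T) : measurable A -> bounded_rv \1_A.
Proof.
move=> mA; split; first exact: measurable_indic.
by exists 1 => x; rewrite indicE; case: (_ \in _); rewrite ?normr1 ?normr0.
Qed.

Lemma bounded_rv_sum (I : Type) (s : seq I) (F : I -> T -> R) :
  (forall i, bounded_rv (F i)) -> bounded_rv (fun x => \sum_(i <- s) F i x).
Proof.
move=> bF; elim: s => [|i s IH].
  by under eq_fun do rewrite big_nil; exact: bounded_rv_cst.
by under eq_fun do rewrite big_cons; exact: bounded_rvD.
Qed.

Lemma bounded_rv_prod (I : Type) (s : seq I) (F : I -> T -> R) :
  (forall i, bounded_rv (F i)) -> bounded_rv (fun x => \prod_(i <- s) F i x).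
Proof.
move=> bF; elim: s => [|i s IH].
  by under eq_fun do rewrite big_nil; exact: bounded_rv_cst.
by under eq_fun do rewrite big_cons; exact: bounded_rvM.
Qed.

Lemma Rintegral_sum (I : Type) (s : seq I) (F : I -> T -> R) :
  (forall i, bounded_rv (F i)) ->
  \int[P]_x (\sum_(i <- s) F i x) = \sum_(i <- s) \int[P]_x F i x.
Proof.
move=> bF; elim: s => [|i s IH].
  rewrite big_nil; under eq_Rintegral do rewrite big_nil.
  by rewrite Rintegral_cst// mul0r.
rewrite big_cons -IH -RintegralD//; last 2 first.
- exact: bounded_rv_integrable.
- by apply: bounded_rv_integrable; exact: bounded_rv_sum.
by apply: eq_Rintegral => x _; rewrite big_cons.
Qed.

Lemma Rintegral_cst1 r : \int[P]_x (fun=> r) x = r.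
Proof.
transitivity (r * fine (P setT)); first exact: Rintegral_cst.
by rewrite probability_setT mulr1.
Qed.

Lemma Rintegral_indicT (A : set T) : measurable A -> \int[P]_x \1_A x = fine (P A).
Proof. by move=> mA; rewrite /Rintegral integral_indic// setIT. Qed.

Lemma bounded_rv_normr f : bounded_rv f -> bounded_rv (fun x => `|f x|).
Proof.
move=> [mf [C fC]]; split; first exact: measurableT_comp.
by exists C => x; rewrite normr_id.
Qed.

Lemma normr_Rintegral_le (f : T -> R) C : measurable_fun setT f -> (forall x, `|f x| <= C) ->
  `|\int[P]_x f x| <= C.
Proof.
move=> mf fC.
have bf : bounded_rv f by split=> //; exists C.
rewrite (le_trans (le_normr_Rintegral _ _))//; first exact: bounded_rv_integrable.
rewrite -[leRHS](Rintegral_cst1 C); apply: le_Rintegral => //.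
  by apply: bounded_rv_integrable; exact: bounded_rv_normr.
by apply: bounded_rv_integrable; exact: bounded_rv_cst.
Qed.

Lemma le_bounded_Rintegral f g : bounded_rv f -> bounded_rv g ->
  (forall x, f x <= g x) -> \int[P]_x f x <= \int[P]_x g x.
Proof.
by move=> bf bg fg; apply: le_Rintegral => //; exact: bounded_rv_integrable.
Qed.

End BoundedExpectation.

Lemma bounded_rv_comp {R : realType} {d d' : measure_display}
    {T : measurableType d} {T' : measurableType d'} (f : T' -> R) (X : T -> T') :
  measurable_fun setT X -> bounded_rv f -> bounded_rv (fun x => f (X x)).
Proof.
move=> mX [mf [C fC]]; split; last by exists C.
exact: (measurableT_comp mf mX).
Qed.

Section Iid.
Context {R : realType} {d : measure_display} {T : measurableType d} (P : probability T R).
Context (xi : nat -> T -> R) (ixi : iid P xi).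

Let mxi k : measurable_fun setT (xi k) := ixi.1 k.

Lemma iid_preimage_measurable k (B : set R) : measurable B -> measurable (xi k @^-1` B).
Proof. by move=> mB; rewrite -[_ @^-1` _]setTI; exact: mxi. Qed.

Lemma iid_prob_prod (n : nat) (B : 'I_n -> set R) : (forall i, measurable (B i)) ->
  \int[P]_w (\prod_(i < n) \1_(B i) (xi i w)) =
  \prod_(i < n) \int[P]_w \1_(B i) (xi 0%N w).
Proof.
move=> mB.
(* The independence clause of [iid] takes sets indexed by [nat]; indices from [n] on get the whole
   line. *)
pose B' (i : nat) := if insub i is Some j then B j else setT.
have B'E (i : 'I_n) : B' i = B i by rewrite /B' valK.
have mB' i : measurable (B' i) by rewrite /B'; case: insub.
have mbig : measurable (\bigcap_(i in `I_n) (xi i @^-1` B' i)).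
  by apply: bigcap_measurableType => i _; exact: iid_preimage_measurable.
transitivity (\int[P]_w (\1_(\bigcap_(i in `I_n) (xi i @^-1` B' i)) w) : R).
  apply: eq_Rintegral => w _; rewrite indicE.
  have [/set_mem wB|/negP wB] := boolP (w \in _).
    apply: big1 => i _; rewrite indicE mem_set//.
    by have := wB i (ltn_ord i); rewrite /= B'E.
  have [i iB] : exists i : 'I_n, ~ B i (xi i w).
    apply: contrapT => /forallNP nB; apply: wB; apply: mem_set => i /= ltin.
    by have := B'E (Ordinal ltin) => /= ->; apply: contrapT; exact: nB.
  by rewrite (bigD1 i)//= indicE memNset// mul0r.
rewrite Rintegral_indicT// ixi.2.2//.
transitivity (fine (\prod_(i < n) (fine (P (xi 0%N @^-1` B i)))%:E)%E).
  congr fine; apply: eq_bigr => i _; rewrite B'E ixi.2.1// fineK// fin_num_measure//.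
  exact: iid_preimage_measurable.
rewrite prodEFin /=; apply: eq_bigr => i _.
by rewrite -Rintegral_indicT//; exact: iid_preimage_measurable.
Qed.

(* [g] is bounded above, up to [eta], by a step function of finitely many
   levels; for step functions the product rule for events is enough. *)
Lemma iid_expectation_prod_le (n : nat) (g : R -> R) (G eta : R) :
  measurable_fun setT g -> (forall x, 0 <= g x <= G) -> 0 < eta ->
  \int[P]_w (\prod_(k < n) g (xi k w)) <= (\int[P]_w g (xi 0%N w) + eta) ^+ n.
Proof.
move=> mg g0G eta0.
have bgR : bounded_rv g.
  by split=> //; exists G => x; have /andP[g0 gG] := g0G x; rewrite ger0_norm.
have bg k : bounded_rv (fun w => g (xi k w)) by exact: bounded_rv_comp (mxi k) bgR.
(* With this [K] the cells [B v], [v < K], cover the range [[0, G]] of [g], and [s] takes the upper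
   end of the cell as its value. *)
pose K := (Num.trunc (G / eta)).+1.
pose B (v : nat) := g @^-1` `[v%:R * eta, v.+1%:R * eta[.
have mB v : measurable (B v) by rewrite /B -[_ @^-1` _]setTI; exact: mg.
pose s x := \sum_(v < K) (v.+1%:R * eta) * \1_(B v) x.
have bB v : bounded_rv (\1_(B v) : R -> R) by exact: bounded_rv_indic.
have bs : bounded_rv s by apply: bounded_rv_sum => v; exact: bounded_rvZ.
have gs x : g x <= s x <= g x + eta.
  have /andP[g0 gG] := g0G x.
  have ge0 : 0 <= g x / eta by rewrite divr_ge0// ltW.
  have /andP[vl vu] := truncn_itv ge0.
  have vK : (Num.trunc (g x / eta) < K)%N.
    by rewrite ltnS; apply: le_truncn; rewrite ler_pM2r ?invr_gt0.
  rewrite ler_pdivlMr// in vl; rewrite ltr_pdivrMr// in vu.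
  have -> : s x = (Num.trunc (g x / eta)).+1%:R * eta.
    rewrite /s (bigD1 (Ordinal vK))//= indicE mem_set ?mulr1.
      rewrite big1 ?addr0// => i iv; rewrite indicE memNset ?mulr0// /B/= in_itv/=.
      move=> /andP[il iu]; move/eqP: iv; apply; apply: val_inj => /=.
      by apply/esym/truncn_def; rewrite // ler_pdivlMr// il ltr_pdivrMr.
    by rewrite /B/= in_itv/= vl vu.
  by rewrite (ltW vu)/= -natr1 mulrDl mul1r lerD2r.
have bsx k : bounded_rv (fun w => s (xi k w)) by exact: bounded_rv_comp (mxi k) bs.
have bBx k v : bounded_rv (fun w => \1_(B v) (xi k w) : R).
  exact: (bounded_rv_comp (mxi k) (bB v)).
have sE : \int[P]_w s (xi 0%N w) =
    \sum_(v < K) (v.+1%:R * eta) * \int[P]_w \1_(B v) (xi 0%N w).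
  rewrite /s Rintegral_sum => [|v]; last exact: bounded_rvZ.
  by apply: eq_bigr => v _; rewrite RintegralZl//; exact: bounded_rv_integrable.
suff : \int[P]_w (\prod_(k < n) g (xi k w)) <= (\int[P]_w s (xi 0%N w)) ^+ n.
  move=> /le_trans; apply; rewrite lerXn2r// ?nnegrE.
  - by apply: Rintegral_ge0 => w _; have /andP[+ _] := gs (xi 0%N w);
      apply: le_trans; have /andP[] := g0G (xi 0%N w).
  - by rewrite addr_ge0 ?(ltW eta0)//; apply: Rintegral_ge0 => w _;
      have /andP[] := g0G (xi 0%N w).
  rewrite -[X in _ + X](Rintegral_cst1 P) -RintegralD//; last 2 first.
  - exact: bounded_rv_integrable.
  - exact/bounded_rv_integrable/bounded_rv_cst.
  apply: le_bounded_Rintegral => //.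
  - by apply: bounded_rvD => //; exact: bounded_rv_cst.
  - by move=> w; have /andP[] := gs (xi 0%N w).
apply: (@le_trans _ _ (\int[P]_w (\prod_(k < n) s (xi k w)))).
  apply: le_bounded_Rintegral; [exact: bounded_rv_prod..|move=> w].
  apply: ler_prod => k _; have /andP[-> _] := g0G (xi k w).
  by have /andP[] := gs (xi k w).
(* Both sides are expanded over all choices of one level per factor; each term is then a multiple of
   a product of indicators, to which [iid_prob_prod] applies. *)
have distr (F : 'I_n -> 'I_K -> R) :
  \prod_k \sum_v F k v = \sum_(f : {ffun 'I_n -> 'I_K}) \prod_k F k (f k).
  exact: bigA_distr_bigA.
under eq_Rintegral do rewrite /s distr.
rewrite Rintegral_sum => [|f]; last by apply: bounded_rv_prod => k; exact: bounded_rvZ.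
rewrite sE -[n in _ ^+ n]card_ord -prodr_const distr le_eqVlt; apply/orP; left; apply/eqP.
apply: eq_bigr => f _; rewrite big_split/= -iid_prob_prod// -RintegralZl//.
  by apply: eq_Rintegral => w _; rewrite big_split.
by apply: bounded_rv_integrable; exact: bounded_rv_prod.
Qed.

End Iid.

(** * Bernstein's inequality *)

(** Both cases invert [1 - x <= expR (- x)]: with [x = y] when [y <= 0], and with [x = y / 2], then
    squared, when [0 < y <= 1]. *)
Lemma expR_le_quadratic {R : realType} (y : R) : y <= 1 -> expR y <= 1 + y + 2 * y ^+ 2.
Proof.
move=> y1; have [y0|y0] := leP y 0.
  have h : 1 - y <= expR (- y) by exact: expR_ge1Dx.
  have h1 : 0 < 1 - y by lra.
  rewrite -[y in leLHS]opprK expRN; apply: (@le_trans _ _ (1 - y)^-1).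
    by rewrite lef_pV2 ?posrE ?expR_gt0.
  rewrite -div1r ler_pdivrMr//; nra.
have h : 1 - y / 2 <= expR (- (y / 2)) by exact: expR_ge1Dx.
have h1 : 0 < 1 - y / 2 by lra.
have -> : expR y = ((expR (- (y / 2))) ^+ 2)^-1.
  by rewrite -expRM_natl -expRN; congr expR; field.
apply: (@le_trans _ _ ((1 - y / 2) ^+ 2)^-1).
  by rewrite lef_pV2 ?posrE ?exprn_gt0 ?expR_gt0// lerXn2r// nnegrE ?ltW// expR_gt0.
rewrite -div1r ler_pdivrMr ?exprn_gt0//.
have -> : (1 + y + 2 * y ^+ 2) * (1 - y / 2) ^+ 2
  = 1 + y ^+ 2 * (1 - y) * (5 / 4 - y / 2) by field.
by rewrite lerDl !mulr_ge0 ?exprn_ge0//; lra.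
Qed.

Lemma measurable_ge_set {R : realType} {d : measure_display} {T : measurableType d}
  (f : T -> R) (t : R) : measurable_fun setT f -> measurable [set w | t <= f w].
Proof.
move=> mf; rewrite (_ : [set w | _] = setT `&` f @^-1` `[t, +oo[%classic).
  exact: mf measurableT _ (measurable_itv _).
by apply/seteqP; split=> w /=; rewrite in_itv/= andbT => // -[].
Qed.

Section Bernstein.
Context {R : realType} {d : measure_display} {T : measurableType d} (P : probability T R).
Context (xi : nat -> T -> R) (ixi : iid P xi).

Definition emp_dev (n : nat) (f : R -> R) (w : T) : R :=
  n%:R^-1 * \sum_(k < n) f (xi k w) - \int[P]_w f (xi 0%N w).

Lemma bounded_rv_xi (f : R -> R) k : bounded_rv f -> bounded_rv (fun w => f (xi k w)).
Proof. by move=> bf; exact: bounded_rv_comp (ixi.1 k) bf. Qed.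

Lemma bounded_rv_emp_dev n f : bounded_rv f -> bounded_rv (emp_dev n f).
Proof.
move=> bf; apply: bounded_rvB; last exact: bounded_rv_cst.
by apply: bounded_rvZ; apply: bounded_rv_sum => k; exact: bounded_rv_xi.
Qed.

Lemma emp_devD n f g : bounded_rv f -> bounded_rv g ->
  emp_dev n (fun x => f x + g x) = (fun w => emp_dev n f w + emp_dev n g w).
Proof.
move=> bf bg; apply/funext => w; rewrite /emp_dev big_split/= RintegralD//.
- by ring.
- by apply: bounded_rv_integrable; exact: bounded_rv_xi.
- by apply: bounded_rv_integrable; exact: bounded_rv_xi.
Qed.

Lemma emp_devZ n r f : bounded_rv f ->
  emp_dev n (fun x => r * f x) = (fun w => r * emp_dev n f w).
Proof.
move=> bf; apply/funext => w; rewrite /emp_dev -mulr_sumr RintegralZl//.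
- by ring.
- by apply: bounded_rv_integrable; exact: bounded_rv_xi.
Qed.

Lemma emp_dev_sum n (I : Type) (s : seq I) (F : I -> R -> R) :
  (forall i, bounded_rv (F i)) ->
  emp_dev n (fun x => \sum_(i <- s) F i x) = (fun w => \sum_(i <- s) emp_dev n (F i) w).
Proof.
move=> bF; apply/funext => w; elim: s => [|i s IH].
  under [X in emp_dev _ X _]eq_fun do rewrite big_nil.
  by rewrite big_nil /emp_dev Rintegral_cst1 big1 ?mulr0 ?subr0.
rewrite big_cons -IH.
under [X in emp_dev _ X _]eq_fun do rewrite big_cons.
by rewrite emp_devD//; exact: bounded_rv_sum.
Qed.

(** The right-hand side does not depend on [f], so one event for [g] controls all dominated [f] at
    once. On the tail, where no grid is available, this gives uniformity in [u]. *)
Lemma emp_dev_le n (f g : R -> R) w : bounded_rv f -> bounded_rv g ->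
  (forall x, `|f x| <= g x) ->
  `|emp_dev n f w| <= emp_dev n g w + 2 * \int[P]_w g (xi 0%N w).
Proof.
move=> bf bg fg; rewrite /emp_dev (le_trans (ler_normB _ _))//.
have h1 : `|n%:R^-1 * \sum_(k < n) f (xi k w)| <= n%:R^-1 * \sum_(k < n) g (xi k w).
  rewrite normrM ger0_norm ?invr_ge0// ler_wpM2l ?invr_ge0//.
  by rewrite (le_trans (ler_norm_sum _ _ _))// ler_sum.
have h2 : `|\int[P]_w f (xi 0%N w)| <= \int[P]_w g (xi 0%N w).
  have bf0 := bounded_rv_xi 0 bf; have bg0 := bounded_rv_xi 0 bg.
  rewrite (le_trans (le_normr_Rintegral _ _))//; first exact: bounded_rv_integrable.
  by apply: le_bounded_Rintegral => //; exact: bounded_rv_normr.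
lra.
Qed.

(** Exponential Markov inequality with [lam] left free. Since [f - mu] is at most 2 in absolute
    value, [lam <= 2^-1] puts the exponent in the range of [expR_le_quadratic]. The leading 1 in the
    bound is the price of the step-function approximation with [eta = 1 / n], raised to the power
    [n]. *)
Lemma bernstein_upper (n : nat) (f : R -> R) (p lam t : R) : (0 < n)%N ->
  measurable_fun setT f -> (forall x, `|f x| <= 1) ->
  \int[P]_w (f (xi 0%N w)) ^+ 2 <= p -> 0 < lam <= 2^-1 ->
  (P [set w | t <= emp_dev n f w]%R <=
     (expR (1 - n%:R * lam * t + 2 * n%:R * lam ^+ 2 * p))%:E)%E.
Proof.
move=> n0 mf f1 fp /andP[lam0 lam2].
have nR0 : 0 < n%:R :> R by rewrite ltr0n.
have bf : bounded_rv f by split=> //; exists 1.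
pose mu := \int[P]_w f (xi 0%N w).
have bf0 := bounded_rv_xi 0 bf.
have mu1 : `|mu| <= 1 by apply: normr_Rintegral_le => //; exact: bf0.1.
pose g x := expR (lam * (f x - mu)).
have fmu x : `|lam * (f x - mu)| <= 1.
  rewrite normrM gtr0_norm//; have := ler_normB (f x) mu; have := f1 x; nra.
have g0 x : 0 <= g x <= expR 1.
  by rewrite expR_ge0 ler_expR (le_trans (ler_norm _)).
have mg : measurable_fun setT g.
  apply: measurableT_comp => //; apply: measurable_funM => //.
  exact: measurable_funB.
have bg : bounded_rv g.
  by split=> //; exists (expR 1) => x; have /andP[a b] := g0 x; rewrite ger0_norm.
(* The square of [f - mu] is written as [f^2 - mu (2 f - mu)], whose mean is [E f^2 - mu^2], at most
   [p]. *)
have Eg : \int[P]_w g (xi 0%N w) <= 1 + 2 * lam ^+ 2 * p.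
  have bf2 : bounded_rv (fun w => f (xi 0 w) ^+ 2).
    by under eq_fun do rewrite expr2; exact: bounded_rvM.
  have bfmu : bounded_rv (fun w => f (xi 0 w) - mu).
    by apply: bounded_rvB => //; exact: bounded_rv_cst.
  have b2 : bounded_rv (fun w => 2 * lam ^+ 2 * (f (xi 0 w) ^+ 2 + - mu * (2 * f (xi 0 w) - mu))).
    apply: bounded_rvZ; apply: bounded_rvD => //; apply: bounded_rvZ.
    by apply: bounded_rvB; [exact: bounded_rvZ|exact: bounded_rv_cst].
  have b3 : bounded_rv (fun w => 1 + lam * (f (xi 0 w) - mu)).
    by apply: bounded_rvD; [exact: bounded_rv_cst|exact: bounded_rvZ].
  apply: (@le_trans _ _ (\int[P]_w ((1 + lam * (f (xi 0 w) - mu)) +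
      2 * lam ^+ 2 * (f (xi 0 w) ^+ 2 + - mu * (2 * f (xi 0 w) - mu))))).
    apply: le_bounded_Rintegral; [exact: bounded_rv_xi|exact: bounded_rvD|move=> w].
    apply: le_trans (expR_le_quadratic _) _.
      exact: le_trans (ler_norm _) (fmu _).
    by rewrite le_eqVlt; apply/orP; left; apply/eqP; ring.
  have b4 : bounded_rv (fun w => 2 * f (xi 0 w)) by exact: bounded_rvZ.
  have b5 : bounded_rv (fun w => 2 * f (xi 0 w) - mu).
    by apply: bounded_rvB => //; exact: bounded_rv_cst.
  have b6 : bounded_rv (fun w => - mu * (2 * f (xi 0 w) - mu)) by exact: bounded_rvZ.
  have bi := @bounded_rv_integrable _ _ _ P.
  rewrite RintegralD//; [|exact: bi..].
  rewrite RintegralD//; [|exact/bi/bounded_rv_cst|exact/bi/bounded_rvZ].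
  rewrite RintegralZl//; last exact: bi.
  rewrite RintegralB//; [|exact: bi|exact/bi/bounded_rv_cst].
  rewrite RintegralZl//; last exact/bi/bounded_rvD.
  rewrite RintegralD//; [|exact: bi..].
  rewrite RintegralZl//; last exact: bi.
  rewrite RintegralB//; [|exact: bi|exact/bi/bounded_rv_cst].
  rewrite RintegralZl//; last exact: bi.
  rewrite !Rintegral_cst1 -/mu subrr mulr0 addr0 lerD2l.
  rewrite ler_pM2l ?mulr_gt0 ?exprn_gt0//.
  apply: le_trans fp; rewrite gerDl mulNr oppr_le0.
  by rewrite (_ : 2 * mu - mu = mu) ?mulr_sg_ge0 -?expr2 ?sqr_ge0//; ring.
pose A := [set w | t <= emp_dev n f w].
have mA : measurable A.
  by apply: measurable_ge_set; exact: (bounded_rv_emp_dev n bf).1.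
have bprod : bounded_rv (fun w => \prod_(k < n) g (xi k w)).
  by apply: bounded_rv_prod => k; exact: bounded_rv_xi.
have EA : expR (n%:R * lam * t) * fine (P A) <= \int[P]_w (\prod_(k < n) g (xi k w)).
  rewrite -Rintegral_indicT// -RintegralZl//; last first.
    exact/bounded_rv_integrable/bounded_rv_indic.
  apply: le_bounded_Rintegral => //; first exact/bounded_rvZ/bounded_rv_indic.
  move=> w; rewrite -expR_sum.
  have -> : \sum_(k < n) lam * (f (xi k w) - mu) = n%:R * lam * emp_dev n f w.
    rewrite -mulr_sumr sumrB sumr_const card_ord /emp_dev -/mu -[mu *+ n]mulr_natl.
    by field; rewrite gt_eqF.
  rewrite indicE; case: (boolP (w \in A)) => [/set_mem wA|_].
    by rewrite mulr1 ler_expR ler_pM2l// mulr_gt0.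
  by rewrite mulr0 expR_ge0.
have eta0 : 0 < n%:R^-1 :> R by rewrite invr_gt0.
have := le_trans EA (iid_expectation_prod_le ixi n mg g0 eta0).
have h : (\int[P]_w g (xi 0 w) + n%:R^-1) ^+ n <= expR (1 + 2 * n%:R * lam ^+ 2 * p).
  apply: (@le_trans _ _ ((expR (2 * lam ^+ 2 * p + n%:R^-1)) ^+ n)).
    rewrite lerXn2r// ?nnegrE ?expR_ge0//.
      rewrite addr_ge0 ?(ltW eta0)//; apply: Rintegral_ge0 => w _.
      by have /andP[] := g0 (xi 0%N w).
    by apply: le_trans (expR_ge1Dx _); rewrite addrA lerD2r.
  rewrite -expRM_natl ler_expR le_eqVlt; apply/orP; left; apply/eqP.
  by field; rewrite gt_eqF.
move=> /le_trans /(_ h) h'.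
rewrite -[P A]fineK ?fin_num_measure// lee_fin.
rewrite -(ler_pM2l (expR_gt0 (n%:R * lam * t))) (le_trans h')// -expRD ler_expR.
by rewrite le_eqVlt; apply/orP; left; apply/eqP; ring.
Qed.

Lemma measurable_emp_dev_tail n f t : bounded_rv f ->
  measurable [set w | t <= `|emp_dev n f w|].
Proof.
move=> bf; apply: measurable_ge_set.
exact: (bounded_rv_normr (bounded_rv_emp_dev n bf)).1.
Qed.

Lemma bernstein (n : nat) (f : R -> R) (p lam t : R) : (0 < n)%N ->
  measurable_fun setT f -> (forall x, `|f x| <= 1) ->
  \int[P]_w (f (xi 0%N w)) ^+ 2 <= p -> 0 < lam <= 2^-1 ->
  (P [set w | t <= `|emp_dev n f w|]%R <=
     (2 * expR (1 - n%:R * lam * t + 2 * n%:R * lam ^+ 2 * p))%:E)%E.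
Proof.
move=> n0 mf f1 fp lam2.
have bf : bounded_rv f by split=> //; exists 1.
have mN : measurable_fun setT (fun x => -1 * f x) by exact: measurable_funM.
have bN : bounded_rv (fun x => -1 * f x) by exact: bounded_rvZ.
have N1 x : `|-1 * f x| <= 1 by rewrite mulN1r normrN.
have Np : \int[P]_w (-1 * f (xi 0%N w)) ^+ 2 <= p.
  by under eq_Rintegral do rewrite mulN1r sqrrN.
have := bernstein_upper t n0 mN N1 Np lam2.
have := bernstein_upper t n0 mf f1 fp lam2.
set A := [set w | _]; set B := [set w | _]; set C := [set w | _] => hA hB.
have mS g : bounded_rv g -> measurable [set w | t <= emp_dev n g w].
  by move=> bg; apply: measurable_ge_set; exact: (bounded_rv_emp_dev n bg).1.
have mA : measurable A by exact: mS.
have mB : measurable B by exact: mS.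
have : (P C <= P (A `|` B))%E.
  apply: le_measure; rewrite ?inE; [exact: measurable_emp_dev_tail|exact: measurableU|].
  move=> w; rewrite /C /A /B /= emp_devZ// mulN1r.
  by case: (lerP 0 (emp_dev n f w)) => [/ger0_norm|/ltr0_norm] ->; [left|right].
move=> /le_trans; apply; rewrite (le_trans (measureU2 _ _ _))//.
by rewrite mulr_natl mulr2n EFinD leeD.
Qed.

End Bernstein.

(** * Suprema over the frequency *)

Section Taylor.
Context {R : realType}.

(** Derivatives of the cosine are written as phase shifts, so that with [a] affine in [x] each
    coefficient is again a cosine of an affine function of [x]. *)
Definition cos_taylor (K : nat) (a : R) : {poly R} :=
  \poly_(m < K) (cos (a + m%:R * (pi / 2)) / m`!%:R).

Lemma deriv_cos_taylor K a : (cos_taylor K.+1 a)^`() = cos_taylor K (a + pi / 2).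
Proof.
apply/polyP => m; rewrite coef_deriv !coef_poly ltnS; case: ltnP => _; last by rewrite mul0rn.
rewrite -[_ / _ *+ _]mulr_natr factS natrM -mulrA invfM.
have -> : a + m.+1%:R * (pi / 2) = a + pi / 2 + m%:R * (pi / 2) by rewrite -natr1; ring.
by congr (_ * _); rewrite mulrAC mulVf ?mul1r// pnatr_eq0.
Qed.

(** Induction by the mean value theorem: the derivative of the remainder of order [K.+1] at phase
    [a] is the remainder of order [K] at phase [a + pi / 2]. The factorial is given up; only
    [|y| <= 1/2] is needed later. *)
Lemma cos_taylor_le K (a y : R) : `|cos (a + y) - (cos_taylor K a).[y]| <= `|y| ^+ K.
Proof.
elim: K a y => [|K IH] a y.
  by rewrite /cos_taylor poly_def big_ord0 horner0 subr0 expr0 cos_max.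
pose r (x : R) := cos (a + x) - (cos_taylor K.+1 a).[x].
pose dr (x : R) := cos (a + pi / 2 + x) - (cos_taylor K (a + pi / 2)).[x].
have dE (x : R) : is_derive x 1 r (dr x).
  rewrite /dr -deriv_cos_taylor addrAC cosDpihalf; apply: is_deriveB.
  have -> : (fun x0 : R => cos (a + x0)) = cos \o (fun x => a + x) by [].
  rewrite -[- sin _]mulr1; apply: is_derive1_comp.
  by rewrite -[X in is_derive _ _ _ X]add0r; exact: is_deriveD.
have cr x y' : {within `[x, y'], continuous r}.
  apply: derivable_within_continuous => z _; have ? := dE z; exact: ex_derive.
have r0 : r 0 = 0.
  rewrite /r addr0 horner_coef0 coef_poly /= mul0r addr0 fact0 invr1 mulr1 subrr//.
have [c cy rE] : exists2 c, `|c| <= `|y| & r y = dr c * y.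
  have [y0|/ltW y0] := leP 0 y.
    have [c cin rE] := MVT_segment y0 (fun x _ => dE x) (cr 0 y).
    exists c; last by move: rE; rewrite r0 !subr0.
    by move: cin; rewrite in_itv/= => /andP[c0 cy]; rewrite !ger0_norm.
  have [c cin rE] := MVT_segment y0 (fun x _ => dE x) (cr y 0).
  exists c; last by move: rE; rewrite r0 !sub0r mulrN => /oppr_inj.
  by move: cin; rewrite in_itv/= => /andP[yc c0]; rewrite !ler0_norm// lerN2.
rewrite -/(r y) rE normrM exprSr ler_wpM2r// (le_trans (IH _ _))//.
by rewrite lerXn2r// nnegrE.
Qed.

End Taylor.

Lemma geometric_half_sum {R : realType} (K : nat) :
  \sum_(m < K) 2^-1 ^+ m <= 2 :> R.
Proof.
suff -> : \sum_(m < K) 2^-1 ^+ m = 2 - 2 * 2^-1 ^+ K :> R.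
  by rewrite gerBl mulr_ge0 ?exprn_ge0 ?invr_ge0.
elim: K => [|K IH]; first by rewrite big_ord0 expr0; ring.
by rewrite big_ord_recr/= IH exprS; field.
Qed.

Lemma arith_geometric_half_sum {R : realType} (K : nat) :
  \sum_(m < K) 2^-1 ^+ m * m%:R <= 2 :> R.
Proof.
suff -> : \sum_(m < K) 2^-1 ^+ m * m%:R = 2 - 2 * (K%:R + 1) * 2^-1 ^+ K :> R.
  by rewrite gerBl mulr_ge0 ?exprn_ge0 ?invr_ge0// mulr_ge0// addr_ge0.
elim: K => [|K IH]; first by rewrite big_ord0 expr0; ring.
by rewrite big_ord_recr/= IH exprS -natr1; field.
Qed.

Lemma union_bound {R : realType} {d : measure_display} {T : measurableType d}
    (P : probability T R) (I : eqType) (s : seq I) (B : I -> set T) (c : I -> R) :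
  (forall i, measurable (B i)) -> (forall i, (P (B i) <= (c i)%:E)%E) ->
  exists E, [/\ measurable E, (P (~` E) <= (\sum_(i <- s) c i)%:E)%E &
    forall w i, E w -> i \in s -> ~ B i w].
Proof.
move=> mB Bc; elim: s => [|i s [E [mE PE EB]]].
  by exists setT; split=> //; rewrite setCT measure0 big_nil.
exists (E `&` ~` B i); split.
- by apply: measurableI => //; exact: measurableC.
- rewrite setCI setCK big_cons EFinD addeC (le_trans (measureU2 _ _ _))//.
    exact: measurableC.
  exact: leeD PE (Bc i).
- by move=> w j [Ew Bw]; rewrite inE => /predU1P[->//|]; exact: EB.
Qed.

Lemma emp_dev_small {R : realType} {d : measure_display} {T : measurableType d}
    (P : probability T R) (xi : nat -> T -> R) (ixi : iid P xi) n (f : R -> R) r w :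
  (0 < n)%N -> measurable_fun setT f -> (forall x, `|f x| <= r) ->
  `|emp_dev P xi n f w| <= 2 * r.
Proof.
move=> n0 mf fr.
have bf : bounded_rv f by split=> //; exists r.
have e0 : emp_dev P xi n (fun=> r) w = 0.
  rewrite /emp_dev Rintegral_cst1 sumr_const card_ord -[r *+ n]mulr_natl mulrA mulVf.
    by rewrite mul1r subrr.
  by rewrite pnatr_eq0 -lt0n.
have := emp_dev_le ixi n w bf (bounded_rv_cst r) fr.
by rewrite e0 add0r Rintegral_cst1.
Qed.

Section Level.
Context {R : realType} {d : measure_display} {T : measurableType d} (P : probability T R).
Context (xi : nat -> T -> R) (ixi : iid P xi).

Lemma measurable_cos_affine (u a : R) : measurable_fun setT (fun x : R => cos (u * x + a)).
Proof.
apply: continuous_measurable_fun => x.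
apply: (@continuous_comp _ _ _ (fun x : R => u * x + a) cos); last exact: continuous_cos.
by apply: cvgD; [apply: cvgM; [exact: cvg_cst|exact: cvg_id]|exact: cvg_cst].
Qed.

(* A grid of mesh [1 / (2 M)] in [u] suffices: around a grid point the cosine
   is replaced by its Taylor polynomial, each coefficient of which is an
   empirical mean of a function bounded by [1] with weight at most [2 ^ - m]. *)
Lemma emp_dev_cos_level (n K : nat) (A : set R) (L l p lam a b : R) :
  (0 < n)%N -> measurable A -> 0 <= L -> 0 <= l -> 0 <= b ->
  (forall x, A x -> `|x| <= expR l) ->
  \int[P]_w \1_A (xi 0%N w) <= p -> 0 < lam <= 2^-1 ->
  exists E, [/\ measurable E, (P (~` E) <= (expR (- b))%:E)%E &
    forall w u, E w -> `|u| <= expR L ->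
      `|emp_dev P xi n (fun x => cos (u * x + a) * \1_A x) w| <=
        (2 * b + 14 + 2 * L + 2 * l) / (n%:R * lam) + 4 * lam * p + 2 * 2^-1 ^+ K].
Proof.
move=> n0 mA L0 l0 b0 AM pA lam02.
have /andP[lam0 lam2] := lam02.
have nR0 : 0 < n%:R :> R by rewrite ltr0n.
have nl0 : 0 < n%:R * lam by rewrite mulr_gt0.
set U := expR L; set M := expR l.
have U1 : 1 <= U by rewrite -expR0 ler_expR.
have M1 : 1 <= M by rewrite -expR0 ler_expR.
have M0 : 0 < M by exact: expR_gt0.
(* The interval [[- U, U]] has length [2 U], hence about [4 U M] cells of length [1 / (2 M)]. *)
pose N := (Num.trunc (4 * U * M)).+1.
have NR0 : 0 < N%:R :> R by rewrite ltr0n.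
have lnN : ln N%:R <= 3 + L + l.
  rewrite -[leRHS]expRK ler_ln ?posrE ?expR_gt0// 2!expRD -/U -/M.
  have UM1 : 1 <= U * M by nra.
  have N5 : N%:R <= 5 * (U * M).
    have : 0 <= 4 * U * M by rewrite !mulr_ge0// ltW// expR_gt0.
    by move=> /truncn_itv/andP[+ _]; rewrite /N -natr1; lra.
  have e3 : 5 <= expR 3 :> R.
    have -> : 3 = 3%:R * 1 :> R by rewrite mulr1.
    rewrite expRM_natl; have : 2 <= expR 1 :> R by apply: le_trans (expR_ge1Dx _).
    nra.
  by rewrite (le_trans N5)// -mulrA ler_wpM2r//; lra.
pose ug (g : nat) := - U + g%:R / (2 * M).
(* Dividing [x] by [M] keeps these functions bounded by 1 on [A]; the powers of [M] move into the
   coefficients [cf]. *)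
pose f (i : 'I_N * 'I_K) (x : R) : R :=
  cos (ug i.1 * x + (a + i.2%:R * (pi / 2))) * (x / M) ^+ i.2 * \1_A x.
(* With threshold [t m] the exponent in [bernstein] becomes [- b - 2 - m - ln N]: the last term of
   [B] cancels the variance, [ln N] pays for the grid, [m] for the Taylor orders. The constant 3
   absorbs the leading 1 and leaves [expR (- 2) <= 1/4]. *)
pose B := b + 3 + ln N%:R + 2 * n%:R * lam ^+ 2 * p.
pose t (m : nat) := (B + m%:R) / (n%:R * lam).
have mf i : measurable_fun setT (f i).
  apply: measurable_funM; last exact: measurable_indic.
  apply: measurable_funM; first exact: measurable_cos_affine.
  by apply: measurable_funX; exact: measurable_funM.
have f1 i x : `|f i x| <= \1_A x.
  rewrite /f indicE; case: (boolP (x \in A)) => [/set_mem xA|_]; last by rewrite mulr0 normr0.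
  rewrite mulr1 normrM -[1]mulr1 ler_pM//; first by rewrite cos_max.
  rewrite normrX exprn_ile1// normrM [`|M^-1|]gtr0_norm ?invr_gt0//.
  by rewrite ler_pdivrMr// mul1r AM.
have indic1 x : \1_A x <= 1 :> R by rewrite indicE; case: (_ \in _).
have bf i : bounded_rv (f i) by split=> //; exists 1 => x; exact: le_trans (f1 i x) _.
have f2 i : \int[P]_w f i (xi 0%N w) ^+ 2 <= p.
  apply: le_trans pA; apply: le_bounded_Rintegral.
  - by under eq_fun do rewrite expr2; apply: bounded_rvM; exact: (bounded_rv_xi ixi _ (bf i)).
  - exact: (bounded_rv_xi ixi 0 (bounded_rv_indic mA)).
  move=> w; rewrite -real_normK ?num_real//.
  apply: le_trans (f1 i _); rewrite expr2 ler_piMr//.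
  exact: le_trans (f1 i _) _.
(* Summed over the grid and the orders, these bounds give at most [expR (- b)], whatever [K] is. *)
pose c (i : 'I_N * 'I_K) := expR (- b) / 2 * (2^-1 ^+ i.2 / N%:R).
have PB (i : 'I_N * 'I_K) : (P [set w | t i.2 <= `|emp_dev P xi n (f i) w|]%R <= (c i)%:E)%E.
  apply: le_trans (bernstein ixi (t i.2) n0 (mf i)
    (fun x => le_trans (f1 i x) (indic1 x)) (f2 i) lam02) _.
  rewrite lee_fin /t /c.
  have -> : 1 - n%:R * lam * ((B + i.2%:R) / (n%:R * lam)) + 2 * n%:R * lam ^+ 2 * p
     = - b - 2 - i.2%:R - ln N%:R.
    by rewrite /B; field; rewrite !gt_eqF.
  rewrite expRB lnK ?posrE// expRB expRB.
  have e2 : (expR 2)^-1 <= 4^-1 :> R.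
    rewrite lef_pV2 ?posrE ?expR_gt0//.
    have -> : 2 = 2%:R * 1 :> R by rewrite mulr1.
    rewrite expRM_natl; have : 2 <= expR 1 :> R by apply: le_trans (expR_ge1Dx _).
    nra.
  have ei : (expR i.2%:R)^-1 <= 2^-1 ^+ i.2 :> R.
    rewrite exprVn lef_pV2 ?posrE ?expR_gt0 ?exprn_gt0//.
    have -> : i.2%:R = i.2%:R * 1 :> R by rewrite mulr1.
    rewrite expRM_natl lerXn2r ?nnegrE ?expR_ge0//.
    by apply: le_trans (expR_ge1Dx _).
  have -> : 2 * (expR (- b) / expR 2 / expR i.2%:R / N%:R)
     = expR (- b) / N%:R * (2 * ((expR 2)^-1 * (expR i.2%:R)^-1)) by ring.
  have -> : expR (- b) / 2 * (2^-1 ^+ i.2 / N%:R)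
     = expR (- b) / N%:R * (2 * (4^-1 * 2^-1 ^+ i.2)) by field; rewrite gt_eqF.
  rewrite ler_wpM2l ?divr_ge0 ?expR_ge0// ler_wpM2l//.
  by rewrite ler_pM ?invr_ge0 ?expR_ge0.
have [E [mE PE EB]] := union_bound (index_enum ('I_N * 'I_K)%type)
  (fun i => measurable_emp_dev_tail ixi n (t i.2) (bf i)) PB.
exists E; split=> //.
  apply: le_trans PE _; rewrite lee_fin.
  rewrite -mulr_sumr (_ : \sum_i _ = \sum_(g < N) \sum_(m < K) (2^-1 ^+ m / N%:R)); last first.
    by rewrite pair_bigA.
  under eq_bigr do rewrite -mulr_suml.
  rewrite sumr_const card_ord -[(_ / _) *+ _]mulr_natr.
  set S := (\sum_(m < K) _); have -> : S / N%:R * N%:R = S by rewrite divfK ?gt_eqF.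
  have := @geometric_half_sum R K; rewrite -/S; have := expR_ge0 (- b); nra.
move=> w u Ew uU.
have u0 : 0 <= (u + U) * (2 * M).
  by rewrite mulr_ge0 ?mulr_ge0 ?(ltW M0)//; move: uU; rewrite ler_norml; lra.
have [g gE] : exists g : 'I_N, `|(u - ug g) * M| <= 2^-1.
  have /andP[gl gu] := truncn_itv u0.
  have gN : (Num.trunc ((u + U) * (2 * M)) < N)%N.
    rewrite ltnS; apply: le_truncn => /=.
    move: uU; rewrite ler_norml => /andP[_ uU].
    have -> : 4 * U * M = (U + U) * (2 * M) by ring.
    by rewrite ler_wpM2r ?mulr_ge0 ?(ltW M0)// lerD2r.
  exists (Ordinal gN) => /=; rewrite /ug.
  have -> : (u - (- U + (Num.trunc ((u + U) * (2 * M)))%:R / (2 * M))) * M =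
    ((u + U) * (2 * M) - (Num.trunc ((u + U) * (2 * M)))%:R) / 2 by field; rewrite gt_eqF.
  move: gl gu; rewrite -[X in _ -> is_true (_ < X) -> _]natr1; set q := (u + U) * _; set q' := _%:R => gl gu.
  by rewrite ger0_norm; clear - ixi gl gu; lra.
set v := (u - ug g) * M in gE.
pose cf (m : nat) := v ^+ m / m`!%:R.
have cf2 m : `|cf m| <= 2^-1 ^+ m.
  rewrite /cf normrM normrX [`|_^-1|]ger0_norm ?invr_ge0//.
  apply: (@le_trans _ _ (`|v| ^+ m)).
    by rewrite ler_piMr ?exprn_ge0// invf_le1 ?ltr0n ?fact_gt0// ler1n fact_gt0.
  by rewrite lerXn2r ?nnegrE ?invr_ge0.
pose r (x : R) := (cos (u * x + a) - (cos_taylor K (ug g * x + a)).[(u - ug g) * x]) * \1_A x.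
have dec x : cos (u * x + a) * \1_A x = \sum_(m < K) cf m * f (g, m) x + r x.
  rewrite /r mulrBl addrCA -[LHS]addr0; congr (_ + _).
  apply/esym/eqP; rewrite subr_eq0; apply/eqP.
  rewrite /cos_taylor horner_poly mulr_suml; apply: eq_bigr => m _.
  have -> : (u - ug g) * x = v * (x / M) by rewrite /v; field; rewrite gt_eqF.
  rewrite /f /cf /= [(v * _) ^+ m]exprMn [_ + (a + _)]addrA.
  set e1 := cos _; set e2 := v ^+ m; set e3 := (x / M) ^+ m; set e4 := _^-1; set e5 := \1_A x.
  ring.
have rK x : `|r x| <= 2^-1 ^+ K.
  rewrite /r normrM indicE; case: (boolP (x \in A)) => [/set_mem xA|_]; last first.
    by rewrite normr0 mulr0 exprn_ge0 ?invr_ge0.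
  rewrite normr1 mulr1.
  have -> : u * x + a = ug g * x + a + (u - ug g) * x by ring.
  apply: le_trans (cos_taylor_le _ _ _) _; rewrite lerXn2r ?nnegrE ?invr_ge0//.
  have -> : (u - ug g) * x = v * (x / M) by rewrite /v; field; rewrite gt_eqF.
  rewrite normrM -[leRHS]mulr1 ler_pM// normrM [`|M^-1|]gtr0_norm ?invr_gt0//.
  by rewrite ler_pdivrMr// mul1r AM.
have bcf (m : 'I_K) : bounded_rv (fun x : R => cf m * f (g, m) x) by exact: bounded_rvZ.
have rE : r = fun x => cos (u * x + a) * \1_A x - \sum_(m < K) cf m * f (g, m) x.
  by apply/funext => x; rewrite dec; ring.
have bS : bounded_rv (fun x => \sum_(m < K) cf m * f (g, m) x) by exact: bounded_rv_sum.
have br : bounded_rv r.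
  rewrite rE; apply: bounded_rvB => //; apply: bounded_rvM; last exact: bounded_rv_indic.
  by split; [exact: measurable_cos_affine|exists 1 => x; rewrite cos_max].
rewrite (_ : (fun x => _) = fun x => \sum_(m < K) cf m * f (g, m) x + r x); last first.
  by apply/funext => x; rewrite dec.
rewrite (emp_devD ixi)// (emp_dev_sum ixi)//.
have h2 := emp_dev_small ixi w n0 br.1 rK.
have h1 : `|\sum_(m < K) emp_dev P xi n (fun x => cf m * f (g, m) x) w| <=
    \sum_(m < K) 2^-1 ^+ m * t m.
  rewrite (le_trans (ler_norm_sum _ _ _))// ler_sum// => m _.
  rewrite (emp_devZ ixi)// normrM ler_pM// ltW// ltNge; apply/negP.
  by apply: (EB w (g, m) Ew); rewrite mem_index_enum.
have h3 : \sum_(m < K) 2^-1 ^+ m * t m <= (2 * B + 2) / (n%:R * lam).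
  rewrite /t; under eq_bigr do rewrite mulrA mulrDr.
  rewrite -mulr_suml ler_pM2r ?invr_gt0// big_split/= -mulr_suml.
  rewrite lerD ?arith_geometric_half_sum// ler_wpM2r ?geometric_half_sum//.
  have p0 : 0 <= p by apply: le_trans pA; apply: Rintegral_ge0 => w' _; rewrite indicE.
  have lnN0 : 0 <= ln N%:R :> R by rewrite ln_ge0// ler1n.
  by rewrite /B !addr_ge0// !mulr_ge0// ltW.
rewrite (le_trans (ler_normD _ _))// lerD// (le_trans h1)// (le_trans h3)//.
have -> : 4 * lam * p = (2 * (2 * n%:R * lam ^+ 2 * p)) / (n%:R * lam).
  by field; rewrite !gt_eqF.
rewrite -mulrDl ler_pM2r ?invr_gt0//.
by rewrite /B; clear - ixi lnN; lra.
Qed.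

End Level.

(** * Tail bound from the log-moment and choice of the last shell *)

Section LogMoment.
Context {R : realType} {d : measure_display} {T : measurableType d} (P : probability T R).

Lemma measurable_normr_le (l : R) : measurable [set x : R | `|x| <= l].
Proof.
rewrite (_ : [set x : R | _] = `[- l, l]%classic); first exact: measurable_itv.
by apply/seteqP; split=> x /=; rewrite in_itv/= ler_norml.
Qed.

(** Markov's inequality: beyond [expR l] the integrand of the moment is at least [l] to the power
    [beta], so the moment itself serves as [Cm]. *)
Lemma log_moment_tail (X : T -> R) (beta : R) : measurable_fun setT X -> 0 <= beta ->
  (\int[P]_w ((ln (Num.max `|X w| (expR 1))) `^ beta)%:E < +oo)%E ->
  exists2 Cm, 0 <= Cm & forall l, 1 <= l ->
    \int[P]_w \1_(~` [set x : R | `|x| <= expR l]) (X w) <= Cm * l `^ (- beta).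
Proof.
move=> mX beta0 foo.
pose Y w := ln (Num.max `|X w| (expR 1)) `^ beta.
have mY : measurable_fun setT Y.
  apply: (@measurableT_comp _ _ _ _ _ _ (@powR R ^~ beta)); first exact: measurable_powR.
  apply: measurableT_comp; first exact: measurable_ln.
  by apply: measurable_maxr; [exact: measurableT_comp|exact: measurable_cst].
have Y0 w : (0 <= (Y w)%:E)%E by rewrite lee_fin powR_ge0.
have Yfin : (\int[P]_w (Y w)%:E)%E \is a fin_num.
  by rewrite ge0_fin_numE// integral_ge0.
exists (fine (\int[P]_w (Y w)%:E)%E); first by rewrite fine_ge0// integral_ge0.
move=> l l1; have l0 : 0 < l by exact: lt_le_trans l1.
set S := ~` _.
have mS : measurable S by apply: measurableC; exact: measurable_normr_le.
have mSX : measurable (X @^-1` S) by rewrite -[_ @^-1` _]setTI; exact: mX.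
rewrite powRN ler_pdivlMr ?powR_gt0// mulrC.
have bS : bounded_rv (\1_(X @^-1` S) : T -> R) by exact: bounded_rv_indic.
change (l `^ beta * \int[P]_w \1_(X @^-1` S) w <= fine (\int[P]_w (Y w)%:E)).
rewrite -RintegralZl//; last exact: bounded_rv_integrable.
have bZ : bounded_rv (fun w => l `^ beta * \1_(X @^-1` S) w) by exact: bounded_rvZ.
apply: fine_le => //.
  by apply: integrable_fin_num => //; exact: (bounded_rv_integrable P bZ).
apply: ge0_le_integral => //=.
- by move=> w _; rewrite lee_fin mulr_ge0 ?powR_ge0.
- by apply/measurable_EFinP; exact: bZ.1.
- exact/measurable_EFinP.
move=> w _; rewrite lee_fin indicE; case: (boolP (w \in _)) => [/set_mem|_]; last first.
  by rewrite mulr0 powR_ge0.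
rewrite /S /= => /negP; rewrite -ltNge => lX; rewrite mulr1.
have Xl : expR l <= Num.max `|X w| (expR 1) by rewrite le_max ltW.
rewrite /Y ge0_ler_powR// ?nnegrE ?(ltW l0)//.
  by rewrite ln_ge0// le_max; apply/orP; right; rewrite -[leLHS]expR0 ler_expR.
by rewrite -[leLHS]expRK ler_ln ?posrE ?expR_gt0// (lt_le_trans _ Xl)// expR_gt0.
Qed.

End LogMoment.

(** Used with [x = sqrt n] to find the last shell: the lower bound makes the tail negligible, the
    upper bound keeps [l_J / n] of order [sqrt (L / n)]. The least admissible [J] satisfies both. *)
Lemma dyadic_level {R : realType} (L x : R) : 1 <= L -> 0 <= x ->
  exists J : nat, x <= L * 2 ^+ J /\ L * 2 ^+ J <= L + 2 * x.
Proof.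
move=> L1 x0.
have ex : exists J : nat, x <= L * 2 ^+ J.
  exists (Num.trunc x).+1; have /andP[_ /ltW h] := truncn_itv x0.
  apply: (le_trans h); rewrite -[leLHS]mul1r ler_pM//.
  by rewrite -natrX ler_nat; exact/ltnW/ltn_expl.
case: (ex_minnP ex) => J xJ minJ; exists J; split => //.
case: J xJ minJ => [|J] xJ minJ; first by rewrite expr0; lra.
have : L * 2 ^+ J < x by rewrite ltNge; apply/negP => /minJ; rewrite ltnn.
by rewrite exprS; lra.
Qed.

Lemma geometric_sum_le {R : realFieldType} (r : R) (K : nat) : 0 <= r < 1 ->
  \sum_(j < K) r ^+ j <= (1 - r)^-1.
Proof.
move=> /andP[r0 r1]; have r1' : 0 < 1 - r by lra.
rewrite -[leRHS]mul1r ler_pdivlMr// mulrC.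
suff -> : (1 - r) * \sum_(j < K) r ^+ j = 1 - r ^+ K by rewrite gerBl exprn_ge0.
elim: K => [|K IH]; first by rewrite big_ord0 expr0; ring.
by rewrite big_ord_recr/= mulrDr IH exprS; ring.
Qed.

(** * Summation over the shells *)

Section Supremum.
Context {R : realType} {d : measure_display} {T : measurableType d} (P : probability T R).
Context (xi : nat -> T -> R) (ixi : iid P xi).

Lemma emp_dev_cos_sup (beta : R) : 1 < beta ->
  (\int[P]_w ((ln (Num.max `|xi 0%N w| (expR 1))) `^ beta)%:E < +oo)%E ->
  exists2 C, 0 < C & forall (n : nat) (L a b : R), (0 < n)%N -> 1 <= L <= n%:R -> 0 <= b ->
    exists E, [/\ measurable E, (P (~` E) <= (3 * expR (- b))%:E)%E &
      forall w u, E w -> `|u| <= expR L ->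
        `|emp_dev P xi n (fun x => cos (u * x + a)) w| <= C * (1 + b) * Num.sqrt (L / n%:R)].
Proof.
move=> beta1 foo.
have beta0 : 0 <= beta by lra.
have [Cm Cm0 tailP] := log_moment_tail (ixi.1 0%N) beta0 foo.
pose q : R := 2 `^ (- beta).
(* [rho ^+ 2 = 2 * q] is the factor by which frequency cost times variance changes from one shell to
   the next; [beta > 1] makes it less than 1. *)
pose rho : R := 2 `^ ((1 - beta) / 2).
have q0 : 0 < q by exact: powR_gt0.
have rho0 : 0 < rho by exact: powR_gt0.
have rho2 : rho ^+ 2 = 2 * q.
  by rewrite -powR_mulrn ?powR_ge0// -powRrM divfK// -[2 in RHS]powRr1// -powRD// pnatr_eq0 implybT.
have rho1 : rho < 1.
  rewrite /rho -[1 - beta]opprB mulNr powRN invf_lt1 ?powR_gt0//.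
  have e1 : 1 = 1 `^ ((beta - 1) / 2) :> R by rewrite powR1.
  by rewrite [ltLHS]e1 gt0_ltr_powR ?nnegrE ?ltr1n//; lra.
(* The 1 covers shell 0, whose mass is bounded trivially. Shell [j.+1] lies outside [S j], so its
   mass is bounded by the tail at [l j]; dividing by [q] corrects this shift of index. *)
pose C1 := Num.max 1 (Cm / q).
have C11 : 1 <= C1 by rewrite le_max lexx.
have C1m : Cm <= C1 * q by rewrite -ler_pdivrMr// le_max lexx orbT.
(* The first term comes from the shells; 7 is 1 for all Taylor remainders plus 6 for the threshold
   on the tail; [3 * Cm] comes from the tail mass. *)
exists (24 * (12 + C1 / (1 - rho)) + 7 + 3 * Cm).
  have : 0 <= C1 / (1 - rho) by rewrite divr_ge0//; lra.
  by set z := C1 / _; lra.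
move=> n L a b n0 /andP[L1 Ln] b0.
have nR1 : 1 <= n%:R :> R by rewrite ler1n.
have nR0 : 0 < n%:R :> R by lra.
have L0 : 0 < L by lra.
set kap := Num.sqrt (L / n%:R).
have kap0 : 0 < kap by rewrite sqrtr_gt0 divr_gt0.
have kap2 : kap ^+ 2 = L / n%:R by rewrite sqr_sqrtr// divr_ge0// ltW.
have kap1 : kap <= 1 by rewrite -sqrtr1 ler_sqrt// ler_pdivrMr// mul1r.
have Lkap : L / n%:R <= kap by rewrite -kap2 expr2 ler_piMl// ltW.
have sn0 : 0 < Num.sqrt n%:R :> R by rewrite sqrtr_gt0.
have sn2 : (Num.sqrt n%:R) ^+ 2 = n%:R :> R by rewrite sqr_sqrtr// ltW.
have snkap : (Num.sqrt n%:R)^-1 <= kap.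
  by rewrite -sqrtrV ?(ltW nR0)// ler_sqrt ?divr_ge0 ?(ltW L0) ?(ltW nR0)// ler_peMl// invr_ge0 ltW.
have [J [nJ Jn]] := dyadic_level L1 (ltW sn0).
pose l j := L * 2 ^+ j.
have l2 j : 1 <= 2 ^+ j :> R by rewrite exprn_ege1// ler1n.
have lL j : L <= l j by rewrite /l ler_peMr// ltW.
have l1 j : 1 <= l j by exact: le_trans (lL j).
have lj j : j%:R <= l j.
  rewrite /l -[leLHS]mul1r ler_pM// -natrX ler_nat; exact/ltnW/ltn_expl.
pose S j := [set x : R | `|x| <= expR (l j)].
have mS j : measurable (S j) by exact: measurable_normr_le.
pose A j := if j is i.+1 then S i.+1 `\` S i else S 0%N.
have mA j : measurable (A j) by case: j => [|j]; [exact: mS|exact: measurableD].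
have AS j : A j `<=` S j by case: j => [//|j] x [].
have sumA K x : \sum_(j < K.+1) \1_(A j) x = \1_(S K) x :> R.
  elim: K => [|K IH]; first by rewrite big_ord_recl big_ord0 addr0.
  rewrite big_ord_recr/= IH !indicE in_setD.
  have [xK|xK] := boolP (x \in S K); last by rewrite add0r andbT.
  rewrite andbF addr0; suff -> : x \in S K.+1 by [].
  move/set_mem : xK => xK; apply/mem_set; apply: le_trans xK _.
  by rewrite ler_expR /l ler_pM2l// exprS ler_peMl ?exprn_ge0// ler1n.
pose p j := C1 * q ^+ j.
have pA j : \int[P]_w \1_(A j) (xi 0%N w) <= p j.
  have bx (B : set R) : measurable B -> bounded_rv (fun w => \1_B (xi 0%N w) : R).
    by move=> mB; exact: (bounded_rv_xi ixi 0 (bounded_rv_indic mB)).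
  case: j => [|j].
    rewrite /p expr0 mulr1; apply: le_trans C11; rewrite -[leRHS](Rintegral_cst1 P).
    apply: le_bounded_Rintegral; [exact: bx|exact: bounded_rv_cst|move=> w].
    by rewrite indicE; case: (_ \in _).
  apply: (@le_trans _ _ (Cm * l j `^ (- beta))).
    apply: le_trans (tailP _ (l1 j)).
    apply: le_bounded_Rintegral; [exact: bx|exact: (bx _ (measurableC (mS j)))|move=> w].
    rewrite !indicE in_setD in_setC; case: (_ \in S j); rewrite ?andbF ?andbT//.
    by case: (_ \in _).
  rewrite /p exprS mulrA ler_pM ?powR_ge0//.
  have -> : q ^+ j = (2 ^+ j) `^ (- beta).
    by rewrite -powR_mulrn ?powR_ge0// /q -powRrM mulrC powRrM powR_mulrn.
  have l0 : 0 < l j := lt_le_trans ltr01 (l1 j).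
  rewrite !powRN lef_pV2 ?posrE ?powR_gt0 ?exprn_gt0//.
  apply: ge0_ler_powR => //; rewrite ?nnegrE ?exprn_ge0 ?(ltW l0)//.
  by rewrite /l ler_peMl ?exprn_ge0.
(* The target contribution of shell [j], of the order of [sqrt (p j * l j / n)]. The next definition
   is chosen so that [s j * r j = C1 * p j]. *)
pose r j := C1 * kap * rho ^+ j.
have r0 j : 0 < r j by rewrite !mulr_gt0 ?exprn_gt0// (lt_le_trans ltr01).
have lpos j : 0 < l j by exact: lt_le_trans (l1 j).
pose s j := r j * n%:R / l j.
have s0 j : 0 < s j by exact: divr_gt0 (mulr_gt0 (r0 j) nR0) (lpos j).
have sr j : p j <= s j * r j.
  have -> : s j * r j = C1 * p j.
    rewrite /s /r /p /l.
    have e1 : rho ^+ j * rho ^+ j = 2 ^+ j * q ^+ j.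
      by rewrite -exprMn -expr2 rho2 exprMn.
    transitivity (C1 ^+ 2 * kap ^+ 2 * (rho ^+ j * rho ^+ j) * n%:R / (L * 2 ^+ j)).
      by ring.
    by rewrite e1 kap2; field; rewrite !gt_eqF ?exprn_gt0.
  by rewrite ler_peMl// /p mulr_ge0 ?exprn_ge0 ?(ltW q0)// (le_trans ler01).
(* This balances the two terms of the level bound: [l j / (n * lam j) = 2 * l j / n + r j] and
   [lam j * p j <= r j]. The summand 2 enforces [lam j <= 2^-1]. *)
pose lam j := (2 + s j)^-1.
have lam02 j : 0 < lam j <= 2^-1.
  have h : 0 < 2 + s j by rewrite addr_gt0.
  by rewrite invr_gt0 h /= lef_pV2 ?posrE// lerDl ltW.
(* [K] affects only the Taylor remainder, so it can be taken large enough for the remainders of all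
   [J.+1] shells to sum to at most [kap]. *)
have [K KJ] : exists K : nat, J.+1%:R * (2 * 2^-1 ^+ K) <= kap.
  exists (Num.trunc (J.+1%:R * 2 / kap)).+1.
  have h0 : 0 <= J.+1%:R * 2 / kap by rewrite divr_ge0 ?mulr_ge0// ltW.
  have /andP[_ /ltW h] := truncn_itv h0.
  set k := (Num.trunc _).+1 in h *.
  have h2 : J.+1%:R * 2 / kap <= 2 ^+ k.
    by apply: (le_trans h); rewrite -natrX ler_nat; exact/ltnW/ltn_expl.
  rewrite exprVn mulrA ler_pdivrMr ?exprn_gt0//.
  by move: h2; rewrite ler_pdivrMr// [2 ^+ k * _]mulrC.
(* Confidence [b + j] on shell [j] makes the failure probabilities sum to at most [2 * expR (- b)];
   the added [j] is harmless because [j <= l j]. *)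
have ex j := emp_dev_cos_level ixi K a n0 (mA j) (ltW L0) (ltW (lpos j))
  (addr_ge0 b0 (ler0n _ j)) (fun x Ax => AS j x Ax) (pA j) (lam02 j).
have [F FP] := choice ex.
have mF j : measurable (~` F j) by have [mF _ _] := FP j; exact: measurableC.
have PF j : (P (~` F j) <= (expR (- (b + j%:R)))%:E)%E by have [] := FP j.
have [E1 [mE1 PE1 E1F]] := union_bound (iota 0 J.+1) mF PF.
pose tl := ~` S J.
have mtl : measurable tl by exact: measurableC.
(* Bounds the tail mass: [l J >= sqrt n] and [beta > 1] give a tail of at most [Cm / sqrt n], and
   [L >= 1] gives [1 / sqrt n <= kap]. *)
pose pt := Cm * kap.
have ptl : \int[P]_w \1_tl (xi 0%N w) <= pt.
  apply: le_trans (tailP _ (l1 J)) _; rewrite ler_wpM2l//.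
  apply: le_trans snkap; rewrite powRN lef_pV2 ?posrE ?powR_gt0//.
  by apply: (le_trans nJ); exact: le1r_powR (l1 J) (ltW beta1).
have btl : bounded_rv (\1_tl : R -> R) by exact: bounded_rv_indic.
have tl1 x : `|\1_tl x : R| <= 1.
  by rewrite indicE; case: (_ \in _); rewrite ?normr1 ?normr0.
have ptl2 : \int[P]_w (\1_tl (xi 0%N w)) ^+ 2 <= pt.
  apply: le_trans ptl; rewrite le_eqVlt; apply/orP; left; apply/eqP.
  apply: eq_Rintegral => w _; rewrite indicE.
  by case: (_ \in _); rewrite ?expr1n ?expr0n.
have half : 0 < (2^-1 : R) <= 2^-1 by rewrite invr_gt0 lexx ltr0n.
(* With [lam = 1/2] the exponent in [bernstein] is [- b - 2], and [2 * expR (- 2) <= 1]; the tail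
   thus adds one [expR (- b)] to the two from the shells. *)
pose t := (2 * b + 6) / n%:R + pt.
have PT := bernstein ixi t n0 btl.1 tl1 ptl2 half.
pose E2 := ~` [set w | t <= `|emp_dev P xi n \1_tl w|].
have mE2 : measurable E2 by apply: measurableC; exact: (measurable_emp_dev_tail ixi).
exists (E1 `&` E2); split.
- exact: measurableI.
- rewrite setCI; apply: le_trans (measureU2 _ (measurableC mE1) (measurableC mE2)) _.
  have -> : 3 * expR (- b) = 2 * expR (- b) + expR (- b) by ring.
  rewrite EFinD; apply: leeD.
    apply: le_trans PE1 _; rewrite lee_fin -val_enum_ord big_map big_enum/=.
    apply: (@le_trans _ _ (\sum_(j < J.+1) expR (- b) * 2^-1 ^+ j)).
      apply: ler_sum => j _; rewrite opprD expRD ler_wpM2l ?expR_ge0//.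
      rewrite expRN exprVn lef_pV2 ?posrE ?expR_gt0 ?exprn_gt0//.
      rewrite -[j%:R]mulr1 expRM_natl lerXn2r ?nnegrE ?expR_ge0//.
      by apply: le_trans (expR_ge1Dx _).
    by rewrite -mulr_sumr mulrC ler_wpM2r ?expR_ge0// geometric_half_sum.
  rewrite /E2 setCK; apply: le_trans PT _; rewrite lee_fin.
  have -> : 1 - n%:R * 2^-1 * t + 2 * n%:R * 2^-1 ^+ 2 * pt = - b - 2.
    by rewrite /t; field; rewrite gt_eqF.
  rewrite expRB mulrCA ger_pMr ?expR_gt0// ler_pdivrMr ?expR_gt0// mul1r.
  by apply: le_trans (expR_ge1Dx _); clear - ixi; lra.
move=> w u [E1w E2w] uL.
have bcos : bounded_rv (fun x : R => cos (u * x + a)).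
  by split; [exact: measurable_cos_affine|exists 1 => x; rewrite cos_max].
have bcA j : bounded_rv (fun x => cos (u * x + a) * \1_(A j) x).
  by apply: bounded_rvM => //; exact: bounded_rv_indic.
have bct : bounded_rv (fun x => cos (u * x + a) * \1_tl x) by exact: bounded_rvM.
rewrite (_ : (fun x => _) = fun x => \sum_(j < J.+1) cos (u * x + a) * \1_(A j) x
   + cos (u * x + a) * \1_tl x); last first.
  apply/funext => x; rewrite -mulr_sumr sumA -mulrDr !indicE in_setC.
  by case: (_ \in _); rewrite ?addr0 ?add0r mulr1.
rewrite (emp_devD ixi)//; last exact: bounded_rv_sum.
rewrite (emp_dev_sum ixi)// (le_trans (ler_normD _ _))//.
have hlev j : (j < J.+1)%N ->
   `|emp_dev P xi n (fun x => cos (u * x + a) * \1_(A j) x) w| <=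
   24 * (1 + b) * (2 * l j / n%:R + r j) + 2 * 2^-1 ^+ K.
  move=> jJ; have [_ _ FE] := FP j.
  have Fw : F j w.
    by apply: contrapT => nFw; apply: (E1F w j E1w) => //; rewrite mem_iota.
  apply: le_trans (FE w u Fw uL) _; rewrite lerD2r.
  have lamp : lam j * p j <= r j.
    rewrite /lam mulrC ler_pdivrMr ?addr_gt0// mulrC (le_trans (sr j))//.
    by rewrite ler_pM2r// lerDr.
  have nl : (n%:R * lam j)^-1 = (2 + s j) / n%:R by rewrite invfM invrK mulrC.
  have h1 : 2 * (b + j%:R) + 14 + 2 * L + 2 * l j <= 20 * (1 + b) * l j.
    (* [lra] slows down sharply with the context size, and fails once a section
       variable is cleared *)
    have := lj j; have := lL j; have := l1 j; clear - ixi b0; nra.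
  have h2 : l j / (n%:R * lam j) = 2 * l j / n%:R + r j.
    by rewrite nl /s; field; rewrite !gt_eqF.
  have h3 : (2 * (b + j%:R) + 14 + 2 * L + 2 * l j) / (n%:R * lam j)
      <= 20 * (1 + b) * (2 * l j / n%:R + r j).
    rewrite -h2 mulrA ler_wpM2r// invr_ge0 mulr_ge0// ltW//.
    by have /andP[] := lam02 j.
  have h4 : 0 <= 2 * l j / n%:R by rewrite divr_ge0 ?mulr_ge0// ltW.
  have := r0 j; clear - ixi b0 h3 h4 lamp; nra.
have h1 : `|\sum_(j < J.+1) emp_dev P xi n (fun x => cos (u * x + a) * \1_(A j) x) w| <=
   24 * (1 + b) * (12 * kap + C1 * kap / (1 - rho)) + kap.
  rewrite (le_trans (ler_norm_sum _ _ _))//.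
  apply: (@le_trans _ _ (\sum_(j < J.+1)
      (24 * (1 + b) * (2 * l j / n%:R + r j) + 2 * 2^-1 ^+ K))).
    by apply: ler_sum => j _; exact: hlev.
  rewrite big_split/= sumr_const card_ord -[_ *+ J.+1]mulr_natl lerD//.
  rewrite -mulr_sumr ler_wpM2l ?mulr_ge0 ?addr_ge0// big_split/= lerD//.
    rewrite -mulr_suml -mulr_sumr /l -mulr_sumr.
    (* The linear terms [l j / n] are dominated by the last shell, where [l J <= L + 2 * sqrt n]. *)
    have e : \sum_(j < J.+1) 2 ^+ j <= 2 * 2 ^+ J :> R.
      clear - ixi; elim: J => [|J IH]; first by rewrite big_ord_recl big_ord0 expr0; lra.
      by rewrite big_ord_recr/= exprS; lra.
    have e2 : 2 * (L * \sum_(j < J.+1) 2 ^+ j) <= 4 * L + 8 * Num.sqrt n%:R.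
      have : L * \sum_(j < J.+1) 2 ^+ j <= L * (2 * 2 ^+ J) by rewrite ler_pM2l.
      by move: Jn; clear - ixi; lra.
    apply: (@le_trans _ _ ((4 * L + 8 * Num.sqrt n%:R) / n%:R)).
      by rewrite ler_wpM2r// invr_ge0 ltW.
    have -> : (4 * L + 8 * Num.sqrt n%:R) / n%:R = 4 * (L / n%:R) + 8 * (Num.sqrt n%:R)^-1.
      have -> : (Num.sqrt n%:R)^-1 = Num.sqrt n%:R / n%:R :> R.
        apply: (mulIf (lt0r_neq0 nR0)); rewrite divfK ?gt_eqF// -[X in _ * X]sn2.
        by rewrite expr2 mulrA mulVf ?mul1r// gt_eqF.
      by ring.
    by clear - ixi Lkap snkap; lra.
  rewrite /r -mulr_sumr ler_wpM2l ?mulr_ge0 ?(ltW kap0)//; first by clear - ixi C11; lra.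
  by apply: geometric_sum_le; rewrite ltW.
have h2 : `|emp_dev P xi n (fun x => cos (u * x + a) * \1_tl x) w| <=
   6 * (1 + b) * kap + 3 * Cm * kap.
  have ct x : `|cos (u * x + a) * \1_tl x| <= \1_tl x.
    rewrite normrM indicE; case: (_ \in _); rewrite ?normr1 ?normr0 ?mulr0// mulr1.
    exact: cos_max.
  apply: le_trans (emp_dev_le ixi n w bct btl ct) _.
  have e1 : emp_dev P xi n \1_tl w <= t.
    by apply: le_trans (ler_norm _) _; apply: ltW; rewrite ltNge; exact/negP.
  have e2 : n%:R^-1 <= kap by apply: le_trans Lkap; rewrite ler_peMl// invr_ge0 ltW.
  have e3 : (2 * b + 6) / n%:R <= (2 * b + 6) * kap.
    by rewrite ler_wpM2l//; clear - ixi b0; lra.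
  have : 0 <= b * kap by rewrite mulr_ge0// ltW.
  by move: e1 ptl; rewrite /t /pt; clear - ixi e2 e3; lra.
apply: (le_trans (lerD h1 h2)).
have h0 : 0 <= (1 + b) * kap by rewrite mulr_ge0 ?addr_ge0// ltW.
have h3 : kap <= (1 + b) * kap by rewrite ler_peMl// ?(ltW kap0)//; clear - ixi b0; lra.
have h4 : 3 * Cm * kap <= 3 * Cm * ((1 + b) * kap) by rewrite ler_wpM2l// mulr_ge0.
have -> : C1 * kap / (1 - rho) = C1 / (1 - rho) * kap by rewrite mulrAC.
by clear - ixi h0 h3 h4; lra.
Qed.

End Supremum.

(** * The principal logarithm and its Taylor remainder *)

Section RealDerivatives.
Context {R : realType}.
Implicit Types (f g : R -> R) (t df dg : R).

Lemma is_derive1D f g t df dg : is_derive t 1 f df -> is_derive t 1 g dg ->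
  is_derive t 1 (fun x => f x + g x) (df + dg).
Proof. by move=> ? ?; exact: is_deriveD. Qed.

Lemma is_derive1M f g t df dg : is_derive t 1 f df -> is_derive t 1 g dg ->
  is_derive t 1 (fun x => f x * g x) (df * g t + f t * dg).
Proof.
by move=> ? ?; apply: is_derive_eq; rewrite addrC; congr (_ + _); exact: mulrC.
Qed.

Lemma is_derive1_inv f t df : f t != 0 -> is_derive t 1 f df ->
  is_derive t 1 (fun x => (f x)^-1) (- df / f t ^+ 2).
Proof.
move=> f0 d; have := is_deriveV f0 d => /is_derive_eq; apply.
by rewrite mulNr [LHS]mulNr; congr (- _); exact: mulrC.
Qed.

Lemma is_derive1_div f g t df dg : g t != 0 ->
  is_derive t 1 f df -> is_derive t 1 g dg ->
  is_derive t 1 (fun x => f x / g x) ((df * g t - f t * dg) / g t ^+ 2).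
Proof.
move=> g0 d1 d2; have := is_derive1M d1 (is_derive1_inv g0 d2) => /is_derive_eq.
by apply; field.
Qed.

Lemma is_derive1_affine (a b t : R) : is_derive t 1 (fun x => a + x * b) b.
Proof.
have h := is_derive1M (is_derive_id t 1) (is_derive_cst b t 1).
have := is_derive1D (is_derive_cst a t 1) h => /is_derive_eq; apply.
by rewrite /cst mul1r mulr0 addr0 add0r.
Qed.

End RealDerivatives.

Section PrincipalLog.
Context {R : realType}.

(** The principal logarithm on the right half plane; the arctangent gives the argument only where
    the real part is positive. *)
Definition clog (z : R[i]) : R[i] :=
  Complex (ln (complex.Re z ^+ 2 + complex.Im z ^+ 2) / 2)
          (atan (complex.Im z / complex.Re z)).

Lemma cos_atan_gt0 (v : R) : 0 < cos (atan v).
Proof. by rewrite cos_atan invr_gt0 sqrtr_gt0 ltr_pwDl// sqr_ge0. Qed.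

Lemma cos2_atan (v : R) : cos (atan v) ^+ 2 = (1 + v ^+ 2)^-1.
Proof.
by rewrite cos_atan exprVn sqr_sqrtr// addr_ge0// sqr_ge0.
Qed.

Lemma sin_atanE (v : R) : sin (atan v) = v * cos (atan v).
Proof.
by have h := atanK v; rewrite /tan in h; rewrite -[X in X * _]h divfK// gt_eqF// cos_atan_gt0.
Qed.

Lemma cexp_clog (z : R[i]) : 0 < complex.Re z -> cexp (clog z) = z.
Proof.
case: z => x y /= x0; rewrite /cexp /clog /=.
have q0 : 0 < x ^+ 2 + y ^+ 2 by rewrite ltr_pwDl ?sqr_ge0 ?exprn_gt0.
set E := expR _; set c := cos _.
have E2 : E ^+ 2 = x ^+ 2 + y ^+ 2.
  by rewrite -expRM_natl mulrC divfK// lnK.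
have Ec : E * c = x.
  apply/eqP; rewrite -(@eqrXn2 _ 2)// ?ltW ?mulr_ge0 ?expR_ge0 ?cos_atan_gt0//.
    by rewrite exprMn E2 cos2_atan; apply/eqP; field; rewrite !gt_eqF//.
  by rewrite mulr_gt0 ?expR_gt0 ?cos_atan_gt0.
by rewrite sin_atanE -/c mulrCA Ec divfK// gt_eqF.
Qed.

(** On the segment [s - z = (t - 1) (z - 1)], so the integrand is [(t - 1) (z - 1)^2 / s^2];
    multiplying by the square of the conjugate of [s] makes the denominator [Q ^+ 2] with
    [Q = |s|^2]. *)
Lemma Rrem_integrandE (a b t : R) :
  let X := 1 + t * a in let Y := t * b in let Q := X ^+ 2 + Y ^+ 2 in Q != 0 ->
  Rrem_integrand (Complex (1 + a) b) t =
  Complex ((t - 1) * ((a ^+ 2 - b ^+ 2) * (X ^+ 2 - Y ^+ 2) + 4 * a * b * X * Y) / Q ^+ 2)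
   ((t - 1) * (2 * a * b * (X ^+ 2 - Y ^+ 2) - 2 * X * Y * (a ^+ 2 - b ^+ 2)) / Q ^+ 2).
Proof.
move=> X Y Q Q0; rewrite /Rrem_integrand (_ : 1 = Complex 1 0 :> R[i])//.
have -> : Complex (1 + a) b - Complex 1 0 = Complex a b :> R[i].
  by congr Complex => /=; ring.
have -> : Complex 1 0 + (t%:C)%C * Complex a b = Complex X Y :> R[i].
  by congr Complex => /=; rewrite /X /Y; ring.
have -> : Complex X Y - Complex (1 + a) b = Complex ((t - 1) * a) ((t - 1) * b) :> R[i].
  by congr Complex => /=; rewrite /X /Y; ring.
have -> : Complex X Y ^+ 2 = Complex (X ^+ 2 - Y ^+ 2) (2 * X * Y) :> R[i].
  by rewrite expr2; congr Complex => /=; ring.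
have Q2 : (X ^+ 2 - Y ^+ 2) ^+ 2 + (2 * X * Y) ^+ 2 = Q ^+ 2 by rewrite /Q; ring.
have -> : (Complex (X ^+ 2 - Y ^+ 2) (2 * X * Y))^-1 =
    Complex ((X ^+ 2 - Y ^+ 2) / Q ^+ 2) (- (2 * X * Y / Q ^+ 2)) :> R[i].
  by rewrite -Q2.
by congr Complex => /=; field.
Qed.

Let X (a t : R) := 1 + t * a.
Let Q (a b t : R) := X a t ^+ 2 + (t * b) ^+ 2.
Let fRe (a b t : R) := (t - 1) * ((a ^+ 2 - b ^+ 2) * (X a t ^+ 2 - (t * b) ^+ 2)
  + 4 * a * b * X a t * (t * b)) / Q a b t ^+ 2.
Let fIm (a b t : R) := (t - 1) * (2 * a * b * (X a t ^+ 2 - (t * b) ^+ 2)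
  - 2 * X a t * (t * b) * (a ^+ 2 - b ^+ 2)) / Q a b t ^+ 2.
(* real and imaginary parts of [log s + z / s], the primitive of
   [(s - z) / s ^ 2], along the segment [s = 1 + t (z - 1)] *)
Let GRe (a b t : R) := ln (Q a b t) / 2 + ((1 + a) * X a t + b * (t * b)) / Q a b t.
Let GIm (a b t : R) := atan (t * b / X a t) + (b * X a t - (1 + a) * (t * b)) / Q a b t.

Let Q_gt0 (a b t : R) : 0 < X a t -> 0 < Q a b t.
Proof. by move=> X0; rewrite ltr_pwDl ?sqr_ge0 ?exprn_gt0. Qed.

Let dX (a t : R) : is_derive t 1 (X a) a.
Proof. exact: is_derive1_affine. Qed.

Let dY (b t : R) : is_derive t 1 (fun t => t * b) b.
Proof.
have := is_derive1_affine 0 b t => /is_derive_eq; rewrite (_ : (fun x => 0 + x * b) = fun t => t * b).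
  exact.
by apply/funext => x; rewrite add0r.
Qed.

Let dQ (a b t : R) : is_derive t 1 (Q a b) (2 * (X a t * a + t * b * b)).
Proof.
have := is_derive1D (is_derive1M (dX a t) (dX a t)) (is_derive1M (dY b t) (dY b t)).
by move=> /is_derive_eq; apply; ring.
Qed.

Let dlin (a b c e t : R) : is_derive t 1 (fun t => c * X a t + e * (t * b)) (c * a + e * b).
Proof.
have := is_derive1D (is_derive1M (is_derive_cst c t 1) (dX a t))
  (is_derive1M (is_derive_cst e t 1) (dY b t)).
by move=> /is_derive_eq; apply; rewrite /cst !mul0r !add0r.
Qed.

Let dGRe (a b t : R) : 0 < X a t -> is_derive t 1 (GRe a b) (fRe a b t).
Proof.
move=> X0; have Q0 := Q_gt0 b X0; have Qn := lt0r_neq0 Q0.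
have h1 := is_derive1_comp (is_derive1_ln Q0) (dQ a b t).
have h2 := is_derive1M h1 (is_derive_cst (2^-1 : R) t 1).
have h3 := is_derive1_div Qn (dlin a b (1 + a) b t) (dQ a b t).
have := is_derive1D h2 h3 => /is_derive_eq; apply.
rewrite /cst /fRe; move: Qn; rewrite /Q /X => Qn; field.
exact: Qn.
Qed.

Let dGIm (a b t : R) : 0 < X a t -> is_derive t 1 (GIm a b) (fIm a b t).
Proof.
move=> X0; have Q0 := Q_gt0 b X0; have Qn := lt0r_neq0 Q0; have Xn := lt0r_neq0 X0.
have h1 := @is_derive1_comp _ atan (fun x => x * b / X a x) t _ _
  (is_derive1_atan (t * b / X a t)) (is_derive1_div Xn (dY b t) (dX a t)).
have h3 := is_derive1_div Qn (dlin a b b (- (1 + a)) t) (dQ a b t).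
have e : (fun t => (b * X a t + - (1 + a) * (t * b)) / Q a b t)
   = (fun t => (b * X a t - (1 + a) * (t * b)) / Q a b t).
  by apply/funext => x; rewrite mulNr.
rewrite e in h3.
have := is_derive1D h1 h3 => /is_derive_eq; apply.
have n1 : 1 + (t * b / X a t) ^+ 2 = Q a b t / X a t ^+ 2 by rewrite /Q; field.
rewrite n1 /fIm; move: Qn Xn; rewrite /Q /X => Qn Xn; field.
by rewrite Xn Qn.
Qed.

Lemma Rintegral_FTC01 (F f : R -> R) :
  (forall t : R, 0 <= t <= 1 -> is_derive t 1 F (f t)) ->
  (forall t : R, 0 <= t <= 1 -> {for t, continuous f}) ->
  \int[lebesgue_measure]_(t in `[0, 1]) f t = F 1 - F 0.
Proof.
move=> dF cf; rewrite /Rintegral (@continuous_FTC2 _ f F 0 1)//.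
- by apply: continuous_subspace_itv => t; rewrite in_itv/= => t01; exact: cf.
- have cF t : 0 <= t <= 1 -> {for t, continuous F}.
    move=> t01; apply: differentiable_continuous; apply/derivable1_diffP.
    by have ? := dF t t01; exact: ex_derive.
  split.
  + move=> t; rewrite in_itv/= => /andP[t0 t1].
    by have ? := dF t; apply: ex_derive; apply: dF; rewrite !ltW.
  + by apply: cvg_at_right_filter; apply: cF; rewrite lexx ler01.
  + by apply: cvg_at_left_filter; apply: cF; rewrite lexx ler01.
- move=> t; rewrite in_itv/= => /andP[t0 t1]; rewrite derive1E.
  by have ? := dF t; apply: derive_val; apply: dF; rewrite !ltW.
Qed.

Let cX (a t : R) : X a x @[x --> t] --> X a t.
Proof. by apply: cvgD; [exact: cvg_cst|apply: cvgM; [exact: cvg_id|exact: cvg_cst]]. Qed.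

Let cY (b t : R) : x * b @[x --> t] --> t * b.
Proof. by apply: cvgM; [exact: cvg_id|exact: cvg_cst]. Qed.

Let cT (t : R) : x - 1 @[x --> t] --> t - 1.
Proof. by apply: cvgB; [exact: cvg_id|exact: cvg_cst]. Qed.

Let cXY (a b t : R) : X a x ^+ 2 - (x * b) ^+ 2 @[x --> t] --> X a t ^+ 2 - (t * b) ^+ 2.
Proof.
rewrite !expr2; under eq_fun do rewrite !expr2.
by apply: cvgB; apply: cvgM; [exact: cX|exact: cX|exact: cY|exact: cY].
Qed.

Let cQV (a b t : R) : 0 < X a t -> (Q a b x ^+ 2)^-1 @[x --> t] --> (Q a b t ^+ 2)^-1.
Proof.
move=> X0; have cQ : Q a b x @[x --> t] --> Q a b t.
  rewrite /Q !expr2; under eq_fun do rewrite !expr2.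
  by apply: cvgD; apply: cvgM; [exact: cX|exact: cX|exact: cY|exact: cY].
apply: cvgV; [by rewrite expf_neq0// gt_eqF// (Q_gt0 b X0)|].
by rewrite expr2; under eq_fun do rewrite expr2; exact: cvgM.
Qed.

Let cfRe (a b t : R) : 0 < X a t -> fRe a b x @[x --> t] --> fRe a b t.
Proof.
move=> X0; apply: cvgM; last exact: cQV.
apply: cvgM; first exact: cT.
apply: cvgD; first by apply: cvgM; [exact: cvg_cst|exact: cXY].
by apply: cvgM; [apply: cvgM; [exact: cvg_cst|exact: cX]|exact: cY].
Qed.

Let cfIm (a b t : R) : 0 < X a t -> fIm a b x @[x --> t] --> fIm a b t.
Proof.
move=> X0; apply: cvgM; last exact: cQV.
apply: cvgM; first exact: cT.
apply: cvgB; first by apply: cvgM; [exact: cvg_cst|exact: cXY].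
apply: cvgM; last exact: cvg_cst.
by apply: cvgM; [apply: cvgM; [exact: cvg_cst|exact: cX]|exact: cY].
Qed.

Let X_gt0 (a t : R) : 0 < 1 + a -> 0 <= t <= 1 -> 0 < X a t.
Proof.
move=> a1 /andP[t0 t1]; rewrite /X.
have -> : 1 + t * a = (1 - t) + t * (1 + a) by ring.
have [t0'|t0'] := ltP 0 t; last first.
  by have -> : t = 0; [lra|rewrite mul0r addr0 subr0].
by rewrite ltr_wpDl ?mulr_gt0// subr_ge0.
Qed.

Let RremE (a b : R) : 0 < 1 + a -> Rrem (Complex (1 + a) b) =
  Complex (GRe a b 1 - GRe a b 0) (GIm a b 1 - GIm a b 0).
Proof.
move=> a1; rewrite /Rrem; congr Complex.
- transitivity (\int[lebesgue_measure]_(t in `[0, 1]) fRe a b t).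
    apply: eq_Rintegral => t /set_mem tin.
    have t01 : 0 <= t <= 1 by move: tin; rewrite /= in_itv.
    by rewrite Rrem_integrandE// gt_eqF// (Q_gt0 b (X_gt0 a1 t01)).
  apply: Rintegral_FTC01 => t t01; first exact/dGRe/X_gt0.
  exact/cfRe/X_gt0.
- transitivity (\int[lebesgue_measure]_(t in `[0, 1]) fIm a b t).
    apply: eq_Rintegral => t /set_mem tin.
    have t01 : 0 <= t <= 1 by move: tin; rewrite /= in_itv.
    by rewrite Rrem_integrandE// gt_eqF// (Q_gt0 b (X_gt0 a1 t01)).
  apply: Rintegral_FTC01 => t t01; first exact/dGIm/X_gt0.
  exact/cfIm/X_gt0.
Qed.

(** The primitive [log s + z / s] equals [log z + 1] at [s = z] and [z] at [s = 1]. *)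
Lemma clogE (z : R[i]) : 0 < complex.Re z -> clog z = (z - 1) + Rrem z.
Proof.
case: z => x y /= x0; have xE : x = 1 + (x - 1) by ring.
rewrite (_ : 1 = Complex 1 0 :> R[i])// [in Rrem _]xE RremE -?xE//.
have q0 : x ^+ 2 + y ^+ 2 != 0 by rewrite gt_eqF// ltr_pwDl ?sqr_ge0 ?exprn_gt0.
rewrite /clog /GRe /GIm /Q /X; congr Complex => /=; rewrite !mul0r !mul1r -?xE.
- by rewrite !addr0 expr1n expr0n/= addr0 ln1; field.
- rewrite !addr0 atan0 expr1n expr0n/= addr0; field.
  exact: q0.
Qed.

(* The mean value theorem bounds each component by the sup of the derivative,
   which is at most |z - 1|^2 / |s|^2 with |s| >= 1/2 on the segment. *)
Lemma normc_Rrem_le (z : R[i]) : 2^-1 <= complex.Re z ->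
  Normc.normc (Rrem z) <= 8 * Normc.normc (z - 1) ^+ 2.
Proof.
case: z => x y; rewrite [complex.Re _]/= => x2; have xE : x = 1 + (x - 1) by ring.
set a := x - 1 in xE; have a2 : 2^-1 <= 1 + a by rewrite -xE.
have a1 : 0 < 1 + a by lra.
rewrite (_ : 1 = Complex 1 0 :> R[i])// xE RremE//= subr0.
have -> : 1 + a - 1 = a by ring.
rewrite sqr_sqrtr ?addr_ge0 ?sqr_ge0//.
have Q4 t : 0 <= t <= 1 -> 4^-1 <= Q a y t.
  move=> /andP[t0 t1]; have h : 2^-1 <= X a t by rewrite /X; nra.
  have : 0 <= (t * y) ^+ 2 by rewrite sqr_ge0.
  by rewrite /Q; nra.
have bnd (N t : R) : 0 <= t <= 1 -> `|N| <= (a ^+ 2 + y ^+ 2) * Q a y t ->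
    `|(t - 1) * N / Q a y t ^+ 2| <= 4 * (a ^+ 2 + y ^+ 2).
  move=> t01 NQ; have Q4t := Q4 t t01; have /andP[t0 t1] := t01.
  have Q0 : 0 < Q a y t by lra.
  rewrite normrM normrM [`|_^-1|]gtr0_norm ?invr_gt0 ?exprn_gt0//.
  rewrite ler_pdivrMr ?exprn_gt0//.
  have tt : `|t - 1| <= 1 by rewrite ler_norml; lra.
  have s0 : 0 <= a ^+ 2 + y ^+ 2 by rewrite addr_ge0 ?sqr_ge0.
  apply: (@le_trans _ _ ((a ^+ 2 + y ^+ 2) * Q a y t)).
    by apply: le_trans NQ; rewrite ler_piMl.
  have -> : 4 * (a ^+ 2 + y ^+ 2) * Q a y t ^+ 2 =
    (a ^+ 2 + y ^+ 2) * Q a y t * (4 * Q a y t) by ring.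
  by rewrite ler_peMr ?mulr_ge0 ?(ltW Q0)//; lra.
have mvt (G g : R -> R) : (forall t : R, 0 <= t <= 1 -> is_derive t 1 G (g t)) ->
    (forall t, 0 <= t <= 1 -> `|g t| <= 4 * (a ^+ 2 + y ^+ 2)) ->
    `|G 1 - G 0| <= 4 * (a ^+ 2 + y ^+ 2).
  move=> dG gB.
  have [|||c c01 ->] := @MVT_segment _ G g 0 1.
  - exact: ler01.
  - by move=> t; rewrite in_itv/= => /andP[t0 t1]; apply: dG; rewrite !ltW.
  - apply: derivable_within_continuous => t; rewrite in_itv/= => t01.
    by have ? := dG t t01; exact: ex_derive.
  by rewrite subr0 mulr1 gB//; move: c01; rewrite in_itv.
have hRe : `|GRe a y 1 - GRe a y 0| <= 4 * (a ^+ 2 + y ^+ 2).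
  apply: (mvt _ (fRe a y)) => t t01; first exact/dGRe/X_gt0.
  (* With [w = (z - 1)] times the conjugate of [s], the numerator is the real part of [w^2]; it
     differs from [|w|^2] and [- |w|^2] by twice a square. The imaginary part below uses the same
     [w = u + i v]. *)
  apply: bnd => //; rewrite ler_norml /Q; set Xt := X a t; set Y := t * y.
  apply/andP; split; rewrite -subr_ge0.
    have -> : (a ^+ 2 - y ^+ 2) * (Xt ^+ 2 - Y ^+ 2) + 4 * a * y * Xt * Y -
      - ((a ^+ 2 + y ^+ 2) * (Xt ^+ 2 + Y ^+ 2)) = 2 * (a * Xt + y * Y) ^+ 2 by ring.
    by rewrite mulr_ge0// sqr_ge0.
  have -> : (a ^+ 2 + y ^+ 2) * (Xt ^+ 2 + Y ^+ 2) - ((a ^+ 2 - y ^+ 2) * (Xt ^+ 2 - Y ^+ 2)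
      + 4 * a * y * Xt * Y) = 2 * (a * Y - y * Xt) ^+ 2 by ring.
  by rewrite mulr_ge0// sqr_ge0.
have hIm : `|GIm a y 1 - GIm a y 0| <= 4 * (a ^+ 2 + y ^+ 2).
  apply: (mvt _ (fIm a y)) => t t01; first exact/dGIm/X_gt0.
  apply: bnd => //; rewrite ler_norml /Q; set Xt := X a t; set Y := t * y.
  set u := a * Xt + y * Y; set v := y * Xt - a * Y.
  have -> : (a ^+ 2 + y ^+ 2) * (Xt ^+ 2 + Y ^+ 2) = u ^+ 2 + v ^+ 2 by rewrite /u /v; ring.
  have -> : 2 * a * y * (Xt ^+ 2 - Y ^+ 2) - 2 * Xt * Y * (a ^+ 2 - y ^+ 2) = 2 * u * v.
    by rewrite /u /v; ring.
  have := sqr_ge0 (u - v); have := sqr_ge0 (u + v).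
  have -> : (u + v) ^+ 2 = u ^+ 2 + v ^+ 2 + 2 * u * v by ring.
  have -> : (u - v) ^+ 2 = u ^+ 2 + v ^+ 2 - 2 * u * v by ring.
  by move=> ? ?; apply/andP; split; lra.
have s0 : 0 <= a ^+ 2 + y ^+ 2 by rewrite addr_ge0 ?sqr_ge0.
set p := GRe a y 1 - _ in hRe *; set q := GIm a y 1 - _ in hIm *.
(* The modulus is at most the sum of the two components, each bounded by [4 |z - 1|^2]; hence the
   constant 8. *)
apply: (@le_trans _ _ (`|p| + `|q|)); last by lra.
rewrite -[leRHS]ger0_norm ?addr_ge0// -sqrtr_sqr ler_sqrt ?sqr_ge0//.

have -> : (`|p| + `|q|) ^+ 2 = p ^+ 2 + q ^+ 2 + 2 * (`|p| * `|q|).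
  by rewrite -[p ^+ 2]real_normK ?num_real// -[q ^+ 2]real_normK ?num_real//; ring.
by rewrite lerDl !mulr_ge0.
Qed.

End PrincipalLog.

(** * Existence and uniqueness of the distinguished logarithm *)

Section DistinguishedLog.
Context {R : realType}.
Implicit Types (psi : R -> R[i]) (a : R).

Lemma clog_continuous psi (u : R) : 0 < complex.Re (psi u) ->
  {for u, continuous (fun u => complex.Re (psi u))} ->
  {for u, continuous (fun u => complex.Im (psi u))} ->
  {for u, continuous (fun u => complex.Re (clog (psi u)))} /\
  {for u, continuous (fun u => complex.Im (clog (psi u)))}.
Proof.
move=> x0 cx cy; split => /=.
  apply: cvgM; last exact: cvg_cst.
  pose q (v : R) := complex.Re (psi v) ^+ 2 + complex.Im (psi v) ^+ 2.
  apply: (@continuous_comp _ _ _ q (@ln R)); last first.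
    by apply: continuous_ln; rewrite /q ltr_pwDl ?sqr_ge0 ?exprn_gt0.
  rewrite /q; apply: cvgD; rewrite expr2; under eq_fun do rewrite expr2; exact: cvgM.
apply: (@continuous_comp _ _ _ (fun v => complex.Im (psi v) / complex.Re (psi v)) (@atan R)).
  by apply: cvgM => //; apply: cvgV => //; rewrite gt_eqF.
exact: continuous_atan.
Qed.

Lemma clog1 : clog (1 : R[i]) = 0.
Proof. by rewrite /clog /= expr1n expr0n/= addr0 ln1 !mul0r atan0. Qed.

(** Equality of the imaginary parts modulo [2 pi] is expressed through the cosine, so that no
    integer multiple has to be tracked. *)
Lemma cexp_inj_cos (z w : R[i]) : cexp z = cexp w ->
  complex.Re z = complex.Re w /\ cos (complex.Im z - complex.Im w) = 1.
Proof.
case: z w => [x y] [x' y']; rewrite /cexp /= => -[ec es].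
have h (v v' : R) : (expR v * cos v') ^+ 2 + (expR v * sin v') ^+ 2 = expR v ^+ 2.
  by rewrite !exprMn -mulrDr cos2Dsin2 mulr1.
have ex : expR x = expR x'.
  apply/eqP; rewrite -(@eqrXn2 _ 2) ?expR_ge0//.
  by rewrite -(h x y) ec es h.
split; first exact: expR_inj.
have E0 : expR x' != 0 by rewrite gt_eqF// expR_gt0.
rewrite ex in ec es.
by rewrite cosB (mulfI E0 ec) (mulfI E0 es) -!expr2 cos2Dsin2.
Qed.

Section OnInterval.
Context (psi : R -> R[i]) (a : R) (psi0 : psi 0 = 1).
Context (psi_pos : forall u, `|u| <= a -> 0 < complex.Re (psi u)).
Context (psi_cRe : forall u : R, {for u, continuous (fun u => complex.Re (psi u))}).
Context (psi_cIm : forall u : R, {for u, continuous (fun u => complex.Im (psi u))}).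

Lemma clog_is_dlog : is_dlog psi a (fun u => clog (psi u)).
Proof.
have c (u : R) : u \in `[- a, a] ->
    {for u, continuous (fun u => complex.Re (clog (psi u)))} /\
    {for u, continuous (fun u => complex.Im (clog (psi u)))}.
  rewrite in_itv/= -ler_norml => ua.
  by apply: clog_continuous; [exact: psi_pos|exact: psi_cRe|exact: psi_cIm].
split; [|split; [|split]].
- by apply: continuous_subspace_itv => u uin; have [] := c u uin.
- by apply: continuous_subspace_itv => u uin; have [] := c u uin.
- by rewrite psi0 clog1.
- by move=> u ua; rewrite cexp_clog// psi_pos.
Qed.

(** A connectedness argument: the gap [D] between the imaginary parts is continuous, vanishes at 0
    and satisfies [cos D = 1], so it cannot leave 0 without taking a value that this equation
    forbids. *)
Lemma dlog_unique (L : R -> R[i]) : is_dlog psi a L ->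
  forall u, `|u| <= a -> L u = clog (psi u).
Proof.
move=> [cLR [cLI [L0 LE]]] u ua.
have [_ [cI _]] := clog_is_dlog.
pose D (t : R) := `|complex.Im (L t) - complex.Im (clog (psi t))|.
have cD : {within `[- a, a], continuous D}.
  move=> t; apply: (@continuous_comp (subspace `[- a, a]) R R
    (fun t => complex.Im (L t) - complex.Im (clog (psi t))) (fun x => `|x|)).
    by apply: cvgB; [exact: cLI|exact: cI].
  exact: norm_continuous.
have cosD1 t : `|t| <= a -> cos (D t) = 1.
  move=> ta; have cosnorm (x : R) : cos `|x| = cos x.
    by case: (ger0P x) => _; rewrite ?cosN.
  rewrite /D cosnorm.
  by have [] := cexp_inj_cos (etrans (LE t ta) (esym (cexp_clog (psi_pos ta)))).
have D0 : D 0 = 0 by rewrite /D L0 psi0 clog1 subrr normr0.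
have [ReE _] := cexp_inj_cos (etrans (LE u ua) (esym (cexp_clog (psi_pos ua)))).
suff Du : D u = 0.
  move: Du => /normr0_eq0/eqP; rewrite subr_eq0 => /eqP ImE.
  by move: ReE ImE; case: (L u) => ? ?; case: (clog _) => ? ? /= -> ->.
apply/eqP; apply: contraT => Dn0.
have Dpos : 0 < D u by rewrite lt_def Dn0 normr_ge0.
(* The cap 1 keeps [v] in [[0, pi]], where the cosine is injective; the intermediate value theorem
   makes [D] attain [v]. *)
pose v := Num.min (D u) 1.
have v0 : 0 < v by rewrite lt_min Dpos ltr01.
have [t [ta Dt]] : exists t, `|t| <= a /\ D t = v.
  have [u0|/ltW u0] := leP 0 u.
    have cDu : {within `[0, u], continuous D}.
      apply: continuous_subspaceW cD => x /=; rewrite !in_itv/=; move: ua; rewrite ler_norml; lra.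
    have [] := @IVT _ D 0 u v u0 cDu.
      by rewrite D0 min_l ?max_r ?(ltW Dpos)// (ltW v0)/= ge_min lexx.
    move=> t; rewrite in_itv/= => /andP[t0 tu] Dt; exists t; split=> //.
    by rewrite ger0_norm// (le_trans tu)// (le_trans _ ua)// ler_norm.
  have cDu : {within `[u, 0], continuous D}.
    apply: continuous_subspaceW cD => x /=; rewrite !in_itv/=; move: ua; rewrite ler_norml; lra.
  have [] := @IVT _ D u 0 v u0 cDu.
    by rewrite D0 min_r ?max_l ?(ltW Dpos)// (ltW v0)/= ge_min lexx.
  move=> t; rewrite in_itv/= => /andP[ut t0] Dt; exists t; split=> //.
  by rewrite ler0_norm// (le_trans _ ua)// ler0_norm// lerN2.
have v1 : v <= pi.
  apply: (@le_trans _ _ 1); first by rewrite ge_min lexx orbT.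
  by have := pi_ge2 R; lra.
have v00 : v = 0.
  apply: cos_inj; rewrite ?in_itv/= ?(ltW v0) ?v1 ?lexx ?pi_ge0//.
  by rewrite -Dt cosD1// cos0.
by move: v0; rewrite v00 ltxx.
Qed.

End OnInterval.
End DistinguishedLog.

(** * Empirical characteristic functions *)

Section EmpiricalCharfun.
Context {R : realType} {d : measure_display} {T : measurableType d} (P : probability T R).
Context (xi : nat -> T -> R) (ixi : iid P xi).

Lemma charfunE (X : T -> R) u :
  charfun P X u = Complex (\int[P]_w cos (u * X w)) (\int[P]_w sin (u * X w)).
Proof. by rewrite /charfun unlock. Qed.

Lemma charfun0 (X : T -> R) : charfun P X 0 = 1.
Proof.
rewrite charfunE; congr Complex.
  under eq_Rintegral do rewrite mul0r cos0.
  exact: Rintegral_cst1.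
under eq_Rintegral do rewrite mul0r sin0.
exact: Rintegral_cst1.
Qed.

Lemma Re_emp_charfun n u w :
  complex.Re (emp_charfun xi n u w) = n%:R^-1 * \sum_(k < n) cos (u * xi k w).
Proof.
rewrite /emp_charfun; have -> : \sum_(k < n) eix (u * xi k w) =
    Complex (\sum_(k < n) cos (u * xi k w)) (\sum_(k < n) sin (u * xi k w)).
  by elim/big_rec3 : _ => // k x y z _ ->.
by rewrite /= mul0r subr0.
Qed.

Lemma Im_emp_charfun n u w :
  complex.Im (emp_charfun xi n u w) = n%:R^-1 * \sum_(k < n) sin (u * xi k w).
Proof.
rewrite /emp_charfun; have -> : \sum_(k < n) eix (u * xi k w) =
    Complex (\sum_(k < n) cos (u * xi k w)) (\sum_(k < n) sin (u * xi k w)).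
  by elim/big_rec3 : _ => // k x y z _ ->.
by rewrite /= mul0r addr0.
Qed.

Lemma emp_charfun0 n w : (0 < n)%N -> emp_charfun xi n 0 w = 1.
Proof.
move=> n0; apply/eqP; rewrite eq_complex Re_emp_charfun Im_emp_charfun.
apply/andP; split; apply/eqP.
  under eq_bigr do rewrite mul0r cos0.
  by rewrite sumr_const card_ord mulVf// pnatr_eq0 -lt0n.
by rewrite big1 ?mulr0// => k _; rewrite mul0r sin0.
Qed.

Lemma sin_cos_shift (x : R) : sin x = cos (x + - (pi / 2)).
Proof. by rewrite cosB cos_pihalf sin_pihalf mulr0 add0r mulr1. Qed.

(** Writing the sine as a shifted cosine lets [emp_dev_cos_sup], with its free phase [a], serve both
    components. *)
Lemma emp_charfun_dev n u w : emp_charfun xi n u w - charfun P (xi 0%N) u =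
  Complex (emp_dev P xi n (fun x => cos (u * x + 0)) w)
          (emp_dev P xi n (fun x => cos (u * x + - (pi / 2))) w).
Proof.
apply/eqP; rewrite eq_complex /emp_dev charfunE.
have -> (z : R[i]) x y : z - Complex x y = Complex (complex.Re z - x) (complex.Im z - y).
  by case: z.
rewrite /= -/complex.Re Re_emp_charfun Im_emp_charfun.
apply/andP; split; apply/eqP; congr (_ * _ - _).
- by apply: eq_bigr => k _; rewrite addr0.
- by apply: eq_Rintegral => w' _; rewrite addr0.
- by apply: eq_bigr => k _; rewrite sin_cos_shift.
- by apply: eq_Rintegral => w' _; rewrite sin_cos_shift.
Qed.

Lemma emp_charfun_sup (beta : R) : 1 < beta ->
  (\int[P]_w ((ln (Num.max `|xi 0%N w| (expR 1))) `^ beta)%:E < +oo)%E ->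
  exists2 C, 0 < C & forall (n : nat) (L b : R), (0 < n)%N -> 1 <= L <= n%:R -> 0 <= b ->
    exists E, [/\ measurable E, (P (~` E) <= (6 * expR (- b))%:E)%E &
      forall w u, E w -> `|u| <= expR L ->
        Normc.normc (emp_charfun xi n u w - charfun P (xi 0%N) u) <=
          C * (1 + b) * Num.sqrt (L / n%:R)].
Proof.
move=> beta1 foo; have [C C0 CP] := emp_dev_cos_sup ixi beta1 foo.
exists (2 * C) => [|n L b n0 Ln b0]; first by rewrite mulr_gt0.
have [E1 [mE1 PE1 E1P]] := CP n L 0 b n0 Ln b0.
have [E2 [mE2 PE2 E2P]] := CP n L (- (pi / 2)) b n0 Ln b0.
exists (E1 `&` E2); split.
- exact: measurableI.
- rewrite setCI; apply: le_trans (measureU2 _ (measurableC mE1) (measurableC mE2)) _.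
  have -> : 6 * expR (- b) = 3 * expR (- b) + 3 * expR (- b) by ring.
  by rewrite EFinD; exact: leeD.
move=> w u [w1 w2] uL; rewrite emp_charfun_dev /=.
have := E1P w u w1 uL; have := E2P w u w2 uL.
set p := emp_dev _ _ _ _ _; set q := emp_dev _ _ _ _ _ => hp hq.
apply: (@le_trans _ _ (`|q| + `|p|)); last by lra.
rewrite -[leRHS]ger0_norm ?addr_ge0// -sqrtr_sqr ler_sqrt ?sqr_ge0//.
have -> : (`|q| + `|p|) ^+ 2 = q ^+ 2 + p ^+ 2 + 2 * (`|q| * `|p|).
  by rewrite -[p ^+ 2]real_normK ?num_real// -[q ^+ 2]real_normK ?num_real//; ring.
by rewrite lerDl !mulr_ge0.
Qed.

Lemma Rintegral_trig_continuous (g : R -> R) (X : T -> R) : continuous g ->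
  (forall x, `|g x| <= 1) -> measurable_fun setT X ->
  continuous (fun u : R => \int[P]_w g (u * X w)).
Proof.
move=> cg g1 mX u.
have mg v : measurable_fun setT (fun w => g (v * X w)).
  apply: measurableT_comp; first exact: continuous_measurable_fun.
  exact: measurable_funM.
have cgX w : continuous (fun v : R => g (v * X w)).
  move=> v; apply: (@continuous_comp R R R (fun v => v * X w) g); last exact: cg.
  by apply: cvgM; [exact: cvg_id|exact: cvg_cst].
have bg v : bounded_rv (fun w => g (v * X w)) by split=> //; exists 1.
apply: (@continuity_under_integral _ _ _ P (fun v w => g (v * X w)) setT _
  (u - 1) (u + 1) _ _ (fun=> 1)) => //.
- by move=> v _; exact: bounded_rv_integrable.
- by apply: aeW => w _ v _; exact: cgX.
- exact/bounded_rv_integrable/bounded_rv_cst.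
- by move=> v _; apply: aeW => w _; exact: g1.
- by rewrite inE/= in_itv/=; lra.
Qed.

Lemma charfun_continuous (X : T -> R) : measurable_fun setT X ->
  continuous (fun u : R => complex.Re (charfun P X u)) /\
  continuous (fun u : R => complex.Im (charfun P X u)).
Proof.
move=> mX; split.
- under eq_fun do rewrite charfunE /=.
  by apply: Rintegral_trig_continuous => //; [exact: continuous_cos|exact: cos_max].
- under eq_fun do rewrite charfunE /=.
  by apply: Rintegral_trig_continuous => //; [exact: continuous_sin|exact: sin_max].
Qed.

Lemma sum_trig_continuous n (g : R -> R) w : continuous g ->
  continuous (fun u : R => n%:R^-1 * \sum_(k < n) g (u * xi k w)).
Proof.
move=> cg u; apply: cvgM; first exact: cvg_cst.
elim: n => [|n IH].
  by rewrite big_ord0; under eq_fun do rewrite big_ord0; exact: cvg_cst.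
rewrite big_ord_recr/=; under eq_fun do rewrite big_ord_recr/=.
apply: cvgD => //; apply: (@continuous_comp R R R (fun v => v * xi n w) g); last exact: cg.
by apply: cvgM; [exact: cvg_id|exact: cvg_cst].
Qed.

Lemma emp_charfun_continuous n w :
  continuous (fun u : R => complex.Re (emp_charfun xi n u w)) /\
  continuous (fun u : R => complex.Im (emp_charfun xi n u w)).
Proof.
split.
- under eq_fun do rewrite Re_emp_charfun.
  exact/sum_trig_continuous/continuous_cos.
- under eq_fun do rewrite Im_emp_charfun.
  exact/sum_trig_continuous/continuous_sin.
Qed.

End EmpiricalCharfun.

Lemma complex_div_continuous {R : realType} (f g : R -> R[i]) :
  (forall u, g u != 0) ->
  continuous (fun u : R => complex.Re (f u)) -> continuous (fun u : R => complex.Im (f u)) ->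
  continuous (fun u : R => complex.Re (g u)) -> continuous (fun u : R => complex.Im (g u)) ->
  continuous (fun u : R => complex.Re (f u / g u)) /\
  continuous (fun u : R => complex.Im (f u / g u)).
Proof.
move=> g0 f1 f2 g1 g2.
pose q (u : R) := complex.Re (g u) ^+ 2 + complex.Im (g u) ^+ 2.
have q0 u : q u != 0.
  apply: contra (g0 u); rewrite /q eq_complex /=.
  by rewrite paddr_eq0 ?sqr_ge0// !expf_eq0.
have cq : continuous q.
  move=> u; rewrite /q; apply: cvgD; rewrite expr2; under eq_fun do rewrite expr2.
    by apply: cvgM; exact: g1.
  by apply: cvgM; exact: g2.
have cV : continuous (fun u : R => (q u)^-1) by move=> u; apply: cvgV; [exact: q0|exact: cq].
have divE (z w : R[i]) :
    z / w = Complex ((complex.Re z * complex.Re w + complex.Im z * complex.Im w) *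
                     (complex.Re w ^+ 2 + complex.Im w ^+ 2)^-1)
                    ((complex.Im z * complex.Re w - complex.Re z * complex.Im w) *
                     (complex.Re w ^+ 2 + complex.Im w ^+ 2)^-1).
  case: z w => [a b] [a' b'].
  by rewrite -[_^-1]/(Complex (a' / (a' ^+ 2 + b' ^+ 2)) (- (b' / (a' ^+ 2 + b' ^+ 2))));
    congr Complex => /=; ring.
split.
- under eq_fun do rewrite divE /=.
  move=> u; apply: cvgM; last exact: cV.
  by apply: cvgD; apply: cvgM; [exact: f1|exact: g1|exact: f2|exact: g2].
- under eq_fun do rewrite divE /=.
  move=> u; apply: cvgM; last exact: cV.
  by apply: cvgB; apply: cvgM; [exact: f2|exact: g1|exact: f1|exact: g2].
Qed.

(** For [n >= 1], [n] to the power [1 / (1 + 2 delta)] is at most [n], so the bandwidth hypothesis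
    gives [L / n -> 0]; eventually [h n <= 1 / e] gives [L >= 1]. This is the range required by
    [emp_charfun_sup]. *)
Lemma log_inv_bandwidth {R : realType} (h : nat -> R) (delta eta : R) :
  (forall n, 0 < h n) -> h n @[n --> \oo] --> 0 -> 0 < delta ->
  (ln (h n)^-1 / (n%:R `^ (1 + 2 * delta)^-1)) @[n --> \oo] --> 0 ->
  0 < eta -> exists N : nat, forall n, (N <= n)%N ->
  [/\ (0 < n)%N, 1 <= ln (h n)^-1 <= n%:R & Num.sqrt (ln (h n)^-1 / n%:R) <= eta].
Proof.
move=> h0 hcvg delta0 hdelta eta0.
have e1 : 0 < (expR 1)^-1 :> R by rewrite invr_gt0 expR_gt0.
have /cvgrPdist_le/(_ _ e1) [N1 _ H1] := hcvg.
pose eps := Num.min 1 (eta ^+ 2).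
have eps0 : 0 < eps by rewrite lt_min ltr01 exprn_gt0.
have /cvgrPdist_le/(_ _ eps0) [N2 _ H2] := hdelta.
exists (maxn 1 (maxn N1 N2)) => n; rewrite !geq_max => /and3P[n0 n1 n2].
have := H1 n n1; rewrite /= sub0r normrN gtr0_norm// => hn.
have := H2 n n2; rewrite /= sub0r normrN => Ln.
have nR1 : 1 <= n%:R :> R by rewrite ler1n.
have nR0 : 0 < n%:R :> R by rewrite ltr0n.
have L1 : 1 <= ln (h n)^-1.
  rewrite -[leLHS]expRK ler_ln ?posrE ?expR_gt0 ?invr_gt0//.
  by rewrite -[leLHS]invrK lef_pV2 ?posrE.
have L0 : 0 < ln (h n)^-1 by lra.
have LnE : ln (h n)^-1 / n%:R <= eps.
  apply: le_trans Ln; rewrite ger0_norm ?divr_ge0 ?powR_ge0 ?(ltW L0)//.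
  rewrite ler_pM2l// lef_pV2 ?posrE ?powR_gt0//.
  rewrite -[leRHS]powRr1 ?(ltW nR0)// ler_powR//.
  have d1 : 1 <= 1 + 2 * delta by rewrite lerDl mulr_ge0// ltW.
  by rewrite invf_le1// (lt_le_trans ltr01 d1).
split=> //.
- rewrite L1/= -[leRHS]mul1r -ler_pdivrMr// (le_trans LnE)// ge_min lexx//.
- rewrite -[leRHS]ger0_norm ?(ltW eta0)// -sqrtr_sqr ler_sqrt ?sqr_ge0//.
  by rewrite (le_trans LnE)// ge_min lexx orbT.
Qed.

Lemma expRN_le_inv {R : realType} (x : R) : 0 < x -> expR (- x) <= x^-1.
Proof.
move=> x0; rewrite expRN lef_pV2 ?posrE ?expR_gt0//.
by apply: le_trans (expR_ge1Dx x); lra.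
Qed.

(** * Choice of the events, the expansion and its rate *)

Unset Implicit Arguments.

Theorem theorem3p2 (R : realType) (d : measure_display) (T : measurableType d)
  (P : probability T R) (xi : nat -> T -> R) (h : nat -> R) (delta beta : R) :
  iid P xi ->
  (exists c : R, 0 < c /\ forall u : R, c <= Normc.normc (charfun P (xi 0%N) u)) ->
  (forall n, 0 < h n) ->
  h n @[n --> \oo] --> 0 ->
  0 < delta ->
  (ln (h n)^-1 / (n%:R `^ (1 + 2 * delta)^-1)) @[n --> \oo] --> 0 ->
  1 < beta ->
  (\int[P]_w ((ln (Num.max `|xi 0%N w| (expR 1))) `^ beta)%:E < +oo)%E ->
  exists A : nat -> set T,
    (forall n, measurable (A n)) /\
    (P (A n) @[n --> \oo] --> 1%E) /\
    (forall n w, A n w ->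
       let psi := fun u => emp_charfun xi n u w / charfun P (xi 0%N) u in
       (exists L, is_dlog psi (h n)^-1 L) /\
       (forall L, is_dlog psi (h n)^-1 L -> forall u, `|u| <= (h n)^-1 ->
          L u = (emp_charfun xi n u w - charfun P (xi 0%N) u) / charfun P (xi 0%N) u
                + Rrem (psi u))) /\
    (forall dbar : R, 0 < dbar <= delta ->
       forall eps : R, 0 < eps -> exists M : R, exists N : nat,
         forall n, (N <= n)%N -> exists E : set T,
           [/\ measurable E, E `<=` A n, (P (~` E) < eps%:E)%E &
             forall w, E w -> forall u, `|u| <= (h n)^-1 ->
               Normc.normc (Rrem (emp_charfun xi n u w / charfun P (xi 0%N) u))
                 <= M * (n%:R^-1 * (ln (h n)^-1) `^ (1 + 2 * dbar))]).
Proof.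
move=> ixi [c [c0 cphi]] h0 hcvg delta0 hdelta beta1 foo.
have [C C0 CP] := emp_charfun_sup ixi beta1 foo.
pose L n := ln (h n)^-1.
have UE n : (h n)^-1 = expR (L n) by rewrite lnK// posrE invr_gt0.
pose kap n := Num.sqrt (L n / n%:R).
(* The last condition says [C * kap n <= c / 4], half of the budget [c / 2] that gives
   [|psi - 1| <= 1/2]. *)
pose good n := [/\ (0 < n)%N, 1 <= L n <= n%:R & kap n <= c / (4 * C)].
pose phi := charfun P (xi 0%N).
have kap_gt0 n : good n -> 0 < kap n.
  move=> [n0 /andP[L1 _] _]; rewrite sqrtr_gt0 divr_gt0 ?ltr0n//.
  exact: lt_le_trans L1.
have phi0 u : phi u != 0.
  apply/eqP => pu; have := cphi u; rewrite -/(phi u) pu Normc.normc0; lra.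
have psi_close n u w r : Normc.normc (emp_charfun xi n u w - phi u) <= r ->
    Normc.normc (emp_charfun xi n u w / phi u - 1) <= r / c.
  move=> er; have -> : emp_charfun xi n u w / phi u - 1 =
    (emp_charfun xi n u w - phi u) / phi u by rewrite mulrBl divff.
  rewrite Normc.normcM Normc.normcV ler_pM ?invr_ge0//.
  - by rewrite /Normc.normc; case: (_ - _).
  - by rewrite (le_trans _ (cphi u))// ltW.
  - by rewrite lef_pV2 ?posrE// (lt_le_trans c0 (cphi u)).
have exA n : exists A, [/\ measurable A,
    good n -> (P (~` A) <= (24 * C * kap n / c)%:E)%E &
    forall w u, A w -> `|u| <= (h n)^-1 ->
     (0 < n)%N /\ Normc.normc (emp_charfun xi n u w / phi u - 1) <= 2^-1].
  (* The expansion must hold on [A n] for every [n]; for the indices that are not good, the empty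
     event makes it vacuous. *)
  have [gn|ngn] := pselect (good n); last by exists set0.
  have k0 := kap_gt0 n gn; have [n0 Ln kc] := gn.
  (* The largest confidence that fits the other half of the budget, [C * b * kap n = c / 4]. It
     tends to infinity as [kap n -> 0], and [expR (- b) <= b^-1] makes the failure probability
     linear in [kap n]. *)
  pose b := c / (4 * C) / kap n.
  have b0 : 0 < b by rewrite !divr_gt0 ?mulr_gt0.
  have [E [mE PE EP]] := CP n (L n) b n0 Ln (ltW b0).
  exists E; split=> //.
    move=> _; apply: le_trans PE _; rewrite lee_fin.
    have -> : 24 * C * kap n / c = 6 * b^-1 by rewrite /b; field; rewrite !gt_eqF.
    by rewrite ler_pM2l// expRN_le_inv.
  move=> w u Ew; rewrite UE => uU; split=> //.
  have -> : 2^-1 = c / 2 / c by field; rewrite gt_eqF.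
  apply: psi_close; apply: le_trans (EP w u Ew uU) _.
  have -> : C * (1 + b) * Num.sqrt (L n / n%:R) = C * kap n + c / 4.
    by rewrite -/(kap n) /b; field; rewrite !gt_eqF.
  have : C * kap n <= c / 4; last by lra.
  rewrite mulrC -ler_pdivlMr//; apply: le_trans kc _.
  by rewrite le_eqVlt; apply/orP; left; apply/eqP; field; rewrite gt_eqF.
have [A AP] := choice exA.
have mA n : measurable (A n) by have [] := AP n.
have PA (eta : R) : 0 < eta -> exists N : nat, forall n, (N <= n)%N ->
    good n /\ (P (~` A n) <= eta%:E)%E.
  move=> eta0.
  pose e := Num.min (c / (4 * C)) (eta * c / (24 * C)).
  have e0 : 0 < e by rewrite lt_min !divr_gt0 ?mulr_gt0.
  have [N NP] := log_inv_bandwidth h0 hcvg delta0 hdelta e0; exists N => n Nn.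
  have [n0 Ln kn] := NP n Nn.
  have gn : good n by split=> //; rewrite (le_trans kn)// ge_min lexx.
  split=> //; have [_ /(_ gn) PAn _] := AP n; apply: le_trans PAn _.
  rewrite lee_fin ler_pdivrMr// mulrC -ler_pdivlMr ?mulr_gt0//.
  by rewrite (le_trans kn)// ge_min lexx orbT.
exists A; split => //; split; [|split].
- have -> : (fun n => P (A n)) = (fun n => (1 - fine (P (~` A n)))%:E).
    apply/funext => n; rewrite probability_setC// fineB ?fin_num_measure//=.
    by rewrite opprB addrC subrK fineK// fin_num_measure.
  apply: cvg_EFin; first exact: nearW.
  rewrite -[X in _ --> X]subr0; apply: cvgB; first exact: cvg_cst.
  apply/cvgrPdist_le => eta eta0; have [N NP] := PA eta eta0.
  exists N => // n /= Nn; rewrite sub0r normrN ger0_norm ?fine_ge0//.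
  have [_] := NP n Nn; rewrite -[P (~` _)]fineK ?lee_fin// fin_num_measure//.
  exact: measurableC.
- move=> n w Aw psi.
  have [_ _ Apsi] := AP n.
  have h1 u : `|u| <= (h n)^-1 -> Normc.normc (psi u - 1) <= 2^-1.
    by move=> uU; have [] := Apsi w u Aw uU.
  have n0 : (0 < n)%N.
    by have [] := Apsi w 0 Aw _ => //; rewrite normr0 invr_ge0 ltW.
  have psi0 : psi 0 = 1 by rewrite /psi emp_charfun0// charfun0 divr1.
  have psi_pos u : `|u| <= (h n)^-1 -> 0 < complex.Re (psi u).
    move=> /h1; case: (psi u) => x y; rewrite (_ : 1 = Complex 1 0 :> R[i])//= => hle.
    have : `|x - 1| <= 2^-1.
      apply: le_trans hle; rewrite -sqrtr_sqr ler_sqrt ?addr_ge0 ?sqr_ge0//.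
      by rewrite lerDl sqr_ge0.
    by rewrite ler_norml; lra.
  have [c1 c2] := emp_charfun_continuous xi n w.
  have [c3 c4] := charfun_continuous P (ixi.1 0%N).
  have [cR cI] := complex_div_continuous phi0 c1 c2 c3 c4.
  split; first by exists (fun u => clog (psi u)); exact: clog_is_dlog.
  move=> L' dL u uU; rewrite (dlog_unique psi0 psi_pos cR cI dL uU).
  by rewrite clogE ?psi_pos//; congr (_ + _); rewrite /psi mulrBl divff// phi0.
move=> dbar /andP[dbar0 _] eps eps0.
(* Chosen so that [6 * expR (- b) <= 6 / b = eps / 4]. This [b] is independent of [n], hence so is
   [M], whose 8 comes from [normc_Rrem_le]. *)
pose b := 24 / eps; have b0 : 0 < b by rewrite divr_gt0.
pose M := 8 * (C * (1 + b) / c) ^+ 2.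
have eps4 : 0 < eps / 4 by rewrite divr_gt0.
have [N NP] := PA (eps / 4) eps4.
exists M, N => n Nn; have [gn PAn] := NP n Nn.
have [n0 Ln _] := gn; have /andP[L1 _] := Ln.
have [E [mE PE EP]] := CP n (L n) b n0 Ln (ltW b0).
(* [A n] keeps the quotient in the half plane where the quadratic bound on [Rrem] holds; [E]
   supplies the rate. *)
exists (A n `&` E); split.
- exact: measurableI.
- by move=> w [].
- apply: (@le_lt_trans _ _ (eps / 4 + eps / 4)%:E); last by rewrite lte_fin; lra.
  rewrite setCI; apply: le_trans (measureU2 _ (measurableC (mA n)) (measurableC mE)) _.
  rewrite EFinD; apply: leeD => //; apply: le_trans PE _; rewrite lee_fin.
  have -> : eps / 4 = 6 * b^-1 by rewrite /b; field; rewrite gt_eqF.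
  by rewrite ler_pM2l// expRN_le_inv.
move=> w [Aw Ew] u uU.
have [_ _ /(_ w u Aw uU) [_ psi2]] := AP n.
rewrite UE in uU; have := psi_close n u w _ (EP w u Ew uU).
rewrite -/(phi u) -/(L n) -/(kap n); move: psi2; set z := _ / _ => z2 zk.
have Rez : 2^-1 <= complex.Re z.
  move: z2; case: (z) => x y; rewrite (_ : 1 = Complex 1 0 :> R[i])//= => hle.
  have : `|x - 1| <= 2^-1.
    apply: le_trans hle; rewrite -sqrtr_sqr ler_sqrt ?addr_ge0 ?sqr_ge0//.
    by rewrite lerDl sqr_ge0.
  by rewrite ler_norml; lra.
apply: le_trans (normc_Rrem_le Rez) _.
have nR0 : 0 < n%:R :> R by rewrite ltr0n.
have k2 : kap n ^+ 2 = n%:R^-1 * L n.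
  by rewrite /kap sqr_sqrtr 1?mulrC// mulr_ge0 ?invr_ge0// ?(ltW nR0)//; lra.
apply: (@le_trans _ _ (M * kap n ^+ 2)).
  rewrite /M -[8 * _ * kap n ^+ 2]mulrA ler_pM2l// -exprMn.
  have -> : C * (1 + b) / c * kap n = C * (1 + b) * kap n / c by rewrite mulrAC.
  rewrite lerXn2r// nnegrE; first by rewrite /Normc.normc; case: (_ - _).
  by apply: le_trans zk; rewrite /Normc.normc; case: (_ - _).
have M0 : 0 <= M by rewrite mulr_ge0 ?sqr_ge0.
rewrite k2; apply: ler_wpM2l => //; rewrite ler_pM2l ?invr_gt0//.
(* The squared deviation has order [L n / n]; [1 <= L n] allows raising [L n] to the power
   [1 + 2 * dbar >= 1]. *)
by apply: le1r_powR => //; lra.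
Qed.
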